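(* Let $\Lambda$ be a basic finite dimensional algebra over an algebraically closed field $k$. Then the box $\mathfrak L_\Lambda$ associated with $\Lambda$ is of $\mathsf{BT}$-type.
   Context: Boxes. $k$ is an algebraically closed field. A box $\mathfrak A=(A,V)$ is a $k$-category $A$ with an $A$-$A$-bimodule $V$ carrying a coassociative comultiplication $\mu:V\to V\otimes_AV$ and a counit $\varepsilon:V\to A$. It is free if $A$ is the path category of a quiver and $\overline V=\ker\varepsilon$ is a free bimodule, i.e. a direct sum of bimodules $A1_i\otimes_k1_jA$; normal if there are $\omega_i\in V(i,i)$ with $\varepsilon(\omega_i)=1_i$, $\mu(\omega_i)=\omega_i\otimes\omega_i$. The biquiver $Q=(I,Q_0,Q_1)$ of a free normal box has vertex set $I=\{1,\dots,n\}=\mathrm{Ob}A$, solid arrows $Q_0$ (free generators of $A$) and dotted arrows $Q_1$ (free generators of $\overline V$; the generator $1_i\otimes1_j$ is a dotted arrow from $j$ to $i$); $I,Q_0,Q_1$ are finite. Paths are composed from right to left; $kQ$ is graded by the number $|p|$ of dotted arrows in a path $p$. The differential is $\partial(a)=\omega_ia-a\omega_j$ for solid $a:j\to i$ and $\partial(v)=\mu(v)-v\otimes\omega_j-\omega_i\otimes v$ for dotted $v$ from $j$ to $i$; it extends to a $k$-linear map $\partial:kQ\to kQ$ of degree $1$ with $\partial^2=0$ and $\partial(xy)=\partial(x)y+(-1)^{|x|}x\partial(y)$. The pair $(Q,\partial)$ (the differential biquiver) determines the box. It is solid-triangular if there is $h:Q_0\to\mathbb N$ such that for each $a\in Q_0$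 only solid arrows $b$ with $h(b)<h(a)$ occur in $\partial(a)$; a box is solid-triangular if it has such a differential biquiver for some choice of free generators. $\mathsf{BT}$-type. A solid-triangular box with (solid-triangular) differential biquiver $(Q,\partial)$, for a suitable choice of free generators, is of $\mathsf{BT}$-type if $Q_0$ contains a set of loops $\mathfrak a=\{a_i:i\to i\mid i\in I\}$ and there is an injective map $\mathfrak b=Q_0\setminus\mathfrak a\to Q_1$, $x\mapsto\tilde x$, such that $\tilde x$ is a dotted arrow from $j$ to $i$ if $x:i\to j$, and $\partial(a_i)=\sum_{x\in\hat{\mathfrak b}(\cdot,i)}(-1)^{|x|}x\tilde x$ for each $i$, where $\tilde{\mathfrak b}=\{\tilde x\mid x\in\mathfrak b\}$, $\hat{\mathfrak b}=\mathfrak b\cup\tilde{\mathfrak b}$, $\tilde{\tilde x}=x$ for $x\in\mathfrak b$, and $\hat{\mathfrak b}(\cdot,i)$ is the set of arrows of $\hat{\mathfrak b}$ ending at $i$. The box $\mathfrak L_\Lambda$. $\Lambda$ is basic: $1=\sum_{i=1}^ne_i$ with pairwise orthogonal primitive idempotents $e_i$ and $\Lambda e_i\not\simeq\Lambda e_j$ for $i\neq j$. Let $\mathfrak R$ be the radical of $\Lambda$, $\Lambda_{ij}=e_i\Lambda e_j$, $\mathfrak R_{ij}=e_i\mathfrak Re_j$; so $\Lambda_{ij}=\mathfrak R_{ij}$ for $i\ne j$ and $\Lambda_{ii}=\mathfrak R_{ii}\oplus ke_i$. Choose a basis $B_0(j,i)$ of $\mathfrak R_{ij}$; set $B(j,i)=B_0(j,i)$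 if $i\ne j$, $B(i,i)=B_0(i,i)\cup\{e_i\}$, $B=\bigcup B(j,i)$, $B_0=\bigcup B_0(j,i)$. For $b\in B_0(j,i)$ let $b^*$ be the corresponding element of the dual basis of $\mathfrak R_{ij}^*=\mathrm{Hom}_k(\mathfrak R_{ij},k)$. Let $\gamma(x,y,b)$ be the structure constants: $xy=\sum_{b\in B}\gamma(x,y,b)b$ for $x,y\in B$. The free normal box $\mathfrak L_\Lambda$ has vertices $1,\dots,n$; the solid arrows $j\to i$ are the elements of $B(j,i)$; each $b\in B_0(j,i)$ gives a dotted arrow $b^*$ from $i$ to $j$; the differential is $$\partial(b)=\sum_{x\in B_0,\,y\in B}\gamma(b,x,y)\,y\,x^*-\sum_{y\in B_0,\,x\in B}\gamma(y,b,x)\,y^*x\quad(b\in B),$$ $$\partial(b^* )=\sum_{x,y\in B_0}\gamma(x,y,b)\,y^*\otimes x^*\quad(b\in B_0).$$ In particular $\partial(e_i)=\sum_{x\in B_0(\cdot,i)}xx^*-\sum_{y\in B_0(i,\cdot)}y^*y$. Up to isomorphism the box does not depend on the choice of the bases, which amounts to a choice of free generators. Its category of finite dimensional modules is identified with the category of elements of the bimodule $\Lambda^*=\mathrm{Hom}_k(\Lambda,k)$: objects are homomorphisms $u\in\mathrm{Hom}_\Lambda(P,\Lambda^*\otimes_\Lambda P)$ with $P$ finitely generated projective, and morphisms $u\to v$, with $v\in\mathrm{Hom}_\Lambda(P',\Lambda^*\otimes_\Lambda P')$, are $\alpha:P\to P'$ with $v\alpha=(1\otimes\alpha)u$. *)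

(* Defs.v *)
From HB Require Import structures.
From mathcomp Require Import all_boot all_algebra falgebra.
From mathcomp Require Import finmap.
From mathcomp.classical Require Import boolp.
From mathcomp.multinomials Require Import monalg.

Set Implicit Arguments.
Unset Strict Implicit.
Unset Printing Implicit Defensive.

Import GRing.Theory.
Local Open Scope ring_scope.
Local Open Scope quotient_scope.

(* Quotient of a left module by the submodule spanned by the elements that     *)
(* satisfy a predicate.                                                        *)
Section LmodQuotient.
Variables (k : nzRingType) (M : lmodType k) (G : M -> Prop).

Inductive spanned : M -> Prop :=
| spanned0 : spanned 0
| spannedP (c : k) (u v : M) : G u -> spanned v -> spanned (c *: u + v).

Lemma spannedD u v : spanned u -> spanned v -> spanned (u + v).
Proof.
by elim=> [|c w z Gw _ IH] sv; rewrite ?add0r // -addrA; apply/spannedP/IH.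
Qed.

Lemma spannedZ c u : spanned u -> spanned (c *: u).
Proof.
elim=> [|d w z Gw _ IH]; first by rewrite scaler0; apply: spanned0.
by rewrite scalerDr scalerA; apply: spannedP.
Qed.

Lemma spannedG u : G u -> spanned u.
Proof.
by move=> Gu; rewrite -[u]addr0 -[u]scale1r; apply: spannedP=> //; apply: spanned0.
Qed.

Definition inspan : {pred M} := fun u => `[< spanned u >].

Lemma inspan_zmod : zmod_closed inspan.
Proof.
split=> [|u v /asboolP su /asboolP sv]; apply/asboolP; first exact: spanned0.
by apply: spannedD => //; rewrite -scaleN1r; apply: spannedZ.
Qed.

HB.instance Definition _ := GRing.isZmodClosed.Build M inspan inspan_zmod.

Definition lquot := Quotient.quot inspan.

HB.instance Definition _ := GRing.Zmodule.on lquot.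
HB.instance Definition _ := ZmodQuotient.on lquot.

Definition lpi (u : M) : lquot := \pi_lquot u.

Lemma lpi_eq u v : lpi u = lpi v <-> spanned (u - v).
Proof.
rewrite /lpi; split=> [/eqP|suv]; last apply/eqP.
  by rewrite -Quotient.idealrBE => /asboolP.
by rewrite -Quotient.idealrBE; apply/asboolP.
Qed.

Definition lquot_scale (c : k) (x : lquot) : lquot := lpi (c *: repr x).

Lemma lpiD u v : lpi (u + v) = lpi u + lpi v.
Proof. exact: pi_addr. Qed.

Lemma lquot_scaleE c u : lquot_scale c (lpi u) = lpi (c *: u).
Proof.
apply/lpi_eq; rewrite -scalerBr; apply/spannedZ/lpi_eq.
by rewrite /lpi reprK.
Qed.

Lemma lpiK (x : lquot) : lpi (repr x) = x.
Proof. by rewrite /lpi reprK. Qed.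

Lemma lquot_scaleA a b x : lquot_scale a (lquot_scale b x) = lquot_scale (a * b) x.
Proof. by rewrite -[x]lpiK !lquot_scaleE scalerA. Qed.
Lemma lquot_scale1 x : lquot_scale 1 x = x.
Proof. by rewrite -[x]lpiK !lquot_scaleE scale1r. Qed.
Lemma lquot_scaleDr : right_distributive lquot_scale +%R.
Proof.
by move=> c x y; rewrite -[x]lpiK -[y]lpiK -lpiD !lquot_scaleE scalerDr lpiD.
Qed.
Lemma lquot_scaleDl x a b :
  lquot_scale (a + b) x = lquot_scale a x + lquot_scale b x.
Proof. by rewrite -[x]lpiK !lquot_scaleE scalerDl lpiD. Qed.

HB.instance Definition _ := GRing.Zmodule_isLmodule.Build k lquot
  lquot_scaleA lquot_scale1 lquot_scaleDr lquot_scaleDl.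

Lemma lpi_linear : linear lpi.
Proof. by move=> c u v; rewrite lpiD -lquot_scaleE. Qed.

HB.instance Definition _ := GRing.isLinear.Build k M lquot *:%R lpi lpi_linear.

End LmodQuotient.

(* Extension by linearity of a function on a basis.                            *)
Definition malg_lift (k : nzRingType) (T : choiceType) (X : lmodType k)
    (f : T -> X) (u : {malg k[T]}) : X :=
  \sum_(p <- msupp u) u@_p *: f p.

Lemma malg_liftEw (k : nzRingType) (T : choiceType) (X : lmodType k)
    (f : T -> X) (u : {malg k[T]}) (d : {fset T}) :
  (msupp u `<=` d)%fset -> malg_lift f u = \sum_(p <- d) u@_p *: f p.
Proof.
move=> sud; rewrite /malg_lift [RHS](big_fsetID _ (mem (msupp u))) /=.
rewrite [X in _ + X]big1_fset ?addr0; last first.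
  move=> p; rewrite !inE /= => /andP[_]; rewrite -mcoeff_eq0 => /eqP-> _.
  by rewrite scale0r.
apply: eq_fbigl => p; rewrite !inE /=; apply/idP/andP => [pu|[]//].
by split=> //; apply: (fsubsetP sud).
Qed.

Lemma malg_lift_linear (k : nzRingType) (T : choiceType) (X : lmodType k)
    (f : T -> X) : linear (malg_lift f).
Proof.
move=> c u v; pose d := (msupp u `|` msupp v `|` msupp (c *: u + v))%fset.
rewrite !(@malg_liftEw _ _ _ f _ d) /d ?fsubsetUr //; first last.
- by rewrite -fsetUA fsubsetUl.
- by rewrite fsetUAC fsubsetUr.
rewrite scaler_sumr -big_split /=; apply: eq_bigr => p _.
by rewrite mcoeffD mcoeffZ scalerDl scalerA.
Qed.

HB.instance Definition _ (k : nzRingType) (T : choiceType) (X : lmodType k)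
  (f : T -> X) := GRing.isLinear.Build k {malg k[T]} X *:%R (malg_lift f)
  (malg_lift_linear f).

Lemma malg_liftU (k : nzRingType) (T : choiceType) (X : lmodType k)
    (f : T -> X) p : malg_lift f << p >> = f p.
Proof.
rewrite (@malg_liftEw _ _ _ _ _ [fset p]%fset) ?msuppU_le //.
by rewrite big_seq_fset1 mcoeffUU scale1r.
Qed.

(* hom i j is the space of morphisms from j to i, written A(i,j); thus         *)
(* composition reads from right to left.                                       *)
Record kcat (k : fieldType) (I : Type) := KCat {
  hom :> I -> I -> lmodType k;
  idc : forall i, hom i i;
  comp : forall i j l, hom i j -> hom j l -> hom i l;
  comp_linl : forall i j l (b : hom j l), linear (fun a : hom i j => comp a b);
  comp_linr : forall i j l (a : hom i j), linear (fun b : hom j l => comp a b);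
  compA : forall i j l m (a : hom i j) (b : hom j l) (c : hom l m),
    comp a (comp b c) = comp (comp a b) c;
  comp1c : forall i j (a : hom i j), comp (idc i) a = a;
  compc1 : forall i j (a : hom i j), comp a (idc j) = a }.

Record bimod (k : fieldType) (I : Type) (A : kcat k I) := Bimod {
  bmod :> I -> I -> lmodType k;
  lact : forall i j l, A i j -> bmod j l -> bmod i l;
  ract : forall i j l, bmod i j -> A j l -> bmod i l;
  lact_linl : forall i j l (v : bmod j l), linear (fun a : A i j => lact a v);
  lact_linr : forall i j l (a : A i j), linear (fun v : bmod j l => lact a v);
  ract_linl : forall i j l (a : A j l), linear (fun v : bmod i j => ract v a);
  ract_linr : forall i j l (v : bmod i j), linear (fun a : A j l => ract v a);
  lact1 : forall i j (v : bmod i j), lact (idc A i) v = v;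
  ract1 : forall i j (v : bmod i j), ract v (idc A j) = v;
  lactA : forall i j l m (a : A i j) (b : A j l) (v : bmod l m),
    lact a (lact b v) = lact (comp a b) v;
  ractA : forall i j l m (v : bmod i j) (a : A j l) (b : A l m),
    ract (ract v a) b = ract v (comp a b);
  lractA : forall i j l m (a : A i j) (v : bmod j l) (b : A l m),
    ract (lact a v) b = lact a (ract v b) }.

Definition bimod_morphism (k : fieldType) (I : Type) (A : kcat k I)
    (V W : bimod A) (f : forall i j, V i j -> W i j) : Prop :=
  [/\ forall i j, linear (@f i j),
      forall i j l (a : A i j) (v : V j l), f i l (lact a v) = lact a (f j l v)
    & forall i j l (v : V i j) (a : A j l), f i l (ract v a) = ract (f i j v) a].

Definition regular_bimod (k : fieldType) (I : Type) (A : kcat k I) : bimod A :=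
  @Bimod k I A (hom A) (@comp k I A) (@comp k I A)
    (@comp_linl k I A) (@comp_linr k I A) (@comp_linl k I A) (@comp_linr k I A)
    (@comp1c k I A) (@compc1 k I A) (@compA k I A)
    (fun i j l m a b c => esym (compA a b c))
    (fun i j l m a b c => esym (compA a b c)).

(* (V (x)_A W)(i,l) is the direct sum of the V(i,j) (x)_k W(j,l) modulo the    *)
(* relations va (x) w = v (x) aw.                                              *)
Section Tensor.
Variables (k : fieldType) (I : choiceType) (A : kcat k I) (V W : bimod A).

Definition tpair i l := {j : I & (V i j * W j l)%type}.
Definition tpr i l j (v : V i j) (w : W j l) : {malg k[tpair i l]} :=
  << Tagged (fun j => (V i j * W j l)%type) (v, w) >>.

Inductive tensor_rel i l : {malg k[tpair i l]} -> Prop :=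
| tensor_rel_linl j c (v v' : V i j) (w : W j l) :
    tensor_rel (tpr (c *: v + v') w - (c *: tpr v w + tpr v' w))
| tensor_rel_linr j c (v : V i j) (w w' : W j l) :
    tensor_rel (tpr v (c *: w + w') - (c *: tpr v w + tpr v w'))
| tensor_rel_bal j m (v : V i j) (a : A j m) (w : W m l) :
    tensor_rel (tpr (ract v a) w - tpr v (lact a w)).

Definition tensor_hom i l := lquot (@tensor_rel i l).
HB.instance Definition _ i l := GRing.Lmodule.on (tensor_hom i l).

Definition tens i j l (v : V i j) (w : W j l) : tensor_hom i l :=
  lpi (@tensor_rel i l) (tpr v w).

Definition tensor_lift i l (X : lmodType k)
    (f : forall j, V i j -> W j l -> X) (t : tensor_hom i l) : X :=
  malg_lift (fun p : tpair i l => f (tag p) (tagged p).1 (tagged p).2) (repr t).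

Definition balanced i l (X : lmodType k)
    (f : forall j, V i j -> W j l -> X) : Prop :=
  [/\ forall j w, linear (fun v => f j v w), forall j v, linear (f j v)
    & forall j m v (a : A j m) w, f m (ract v a) w = f j v (lact a w)].

Lemma tens_linl i j l (w : W j l) : linear (fun v : V i j => tens v w).
Proof.
move=> c v v'; rewrite /tens -linearP; apply/lpi_eq/spannedG.
exact: tensor_rel_linl.
Qed.

Lemma tens_linr i j l (v : V i j) : linear (fun w : W j l => tens v w).
Proof.
move=> c w w'; rewrite /tens -linearP; apply/lpi_eq/spannedG.
exact: tensor_rel_linr.
Qed.

Lemma tens_bal i j m l (v : V i j) (a : A j m) (w : W m l) :
  tens (ract v a) w = tens v (lact a w).
Proof. by apply/lpi_eq/spannedG; apply: tensor_rel_bal. Qed.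

Section Lift.
Variables (i l : I) (X : lmodType k) (f : forall j, V i j -> W j l -> X).
Hypothesis bf : balanced f.

Let F (p : tpair i l) := f (tagged p).1 (tagged p).2.

Lemma tensor_lift_spanned u : spanned (@tensor_rel i l) u -> malg_lift F u = 0.
Proof.
have Fpr j v w : malg_lift F (@tpr i l j v w) = f v w by rewrite malg_liftU.
case: bf => fl fr fb; elim=> [|c {}u v Gu _ IH]; first by rewrite linear0.
rewrite (malg_lift_linear F) IH addr0.
suff -> : malg_lift F u = 0 by rewrite scaler0.
case: Gu => [j d x x' w|j d x w w'|j m x a w].
- by rewrite linearB linearP /= !Fpr fl subrr.
- by rewrite linearB linearP /= !Fpr fr subrr.
by rewrite linearB /= !Fpr fb subrr.
Qed.

Lemma tensor_lift_pi u : tensor_lift f (lpi _ u) = malg_lift F u.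
Proof.
apply/eqP; rewrite -subr_eq0 -linearB; apply/eqP/tensor_lift_spanned.
by apply/lpi_eq; rewrite lpiK.
Qed.

Lemma tensor_liftE j (v : V i j) (w : W j l) : tensor_lift f (tens v w) = f v w.
Proof. by rewrite tensor_lift_pi malg_liftU. Qed.

Lemma tensor_lift_linear : linear (tensor_lift f).
Proof.
move=> c x y; rewrite -[x]lpiK -[y]lpiK -linearP !tensor_lift_pi.
exact: linearP.
Qed.

End Lift.

Lemma tensor_ind i l (P : tensor_hom i l -> Prop) : P 0 ->
  (forall j c (v : V i j) (w : W j l) t, P t -> P (c *: tens v w + t)) ->
  forall t, P t.
Proof.
move=> P0 PD t; rewrite -[t]lpiK [repr t]monalgE.
elim: (msupp _ : seq _) => [|[j [v w]] s IH]; first by rewrite big_nil linear0.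
rewrite big_cons linearD.
set c := (X in << X *g _ >>).
suff -> : << c *g existT _ j (v, w) >> = c *: tpr v w.
  by rewrite linearZ /=; apply: PD.
by apply/malgP => p; rewrite mcoeffZ !mcoeffU mulr_natr.
Qed.

Definition tensor_lact i j l (a : A i j) : tensor_hom j l -> tensor_hom i l :=
  tensor_lift (fun m (v : V j m) (w : W m l) => tens (lact a v) w).
Definition tensor_ract i j l (t : tensor_hom i j) (a : A j l) : tensor_hom i l :=
  tensor_lift (fun m (v : V i m) (w : W m j) => tens v (ract w a)) t.

Lemma lact_balanced i j l (a : A i j) :
  balanced (fun m (v : V j m) (w : W m l) => tens (lact a v) w).
Proof.
split=> [m w c v v'|m v c w w'|m n v b w]; rewrite ?lact_linr ?tens_linl //.
  exact: tens_linr.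
by rewrite -lractA tens_bal.
Qed.

Lemma ract_balanced i j l (a : A j l) :
  balanced (fun m (v : V i m) (w : W m j) => tens v (ract w a)).
Proof.
split=> [m w c v v'|m v c w w'|m n v b w]; rewrite ?ract_linl ?tens_linr //.
  exact: tens_linl.
by rewrite lractA tens_bal.
Qed.

Lemma tensor_lactE i j m l (a : A i j) (v : V j m) (w : W m l) :
  tensor_lact a (tens v w) = tens (lact a v) w.
Proof. by rewrite /tensor_lact (tensor_liftE (lact_balanced _ a)). Qed.

Lemma tensor_ractE i j m l (v : V i m) (w : W m j) (a : A j l) :
  tensor_ract (tens v w) a = tens v (ract w a).
Proof. by rewrite /tensor_ract (tensor_liftE (ract_balanced _ a)). Qed.

Lemma tensor_lact_linr i j l (a : A i j) : linear (@tensor_lact i j l a).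
Proof. exact: (tensor_lift_linear (lact_balanced _ a)). Qed.

Lemma tensor_ract_linl i j l (a : A j l) :
  linear (fun t : tensor_hom i j => tensor_ract t a).
Proof. exact: (tensor_lift_linear (ract_balanced _ a)). Qed.

Lemma linear_fun0 (M N : lmodType k) (f : M -> N) : linear f -> f 0 = 0.
Proof.
move=> /(_ 1 0 0); rewrite scaler0 addr0 scale1r => f0.
by apply: (addIr (f 0)); rewrite add0r -f0.
Qed.

Lemma tensor_ext i l (X : lmodType k) (f g : tensor_hom i l -> X) :
  linear f -> linear g ->
  (forall j (v : V i j) (w : W j l), f (tens v w) = g (tens v w)) -> f =1 g.
Proof.
move=> fl gl fg; apply: tensor_ind; first by rewrite !linear_fun0.
by move=> j c v w t IH; rewrite fl gl fg IH.
Qed.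

Lemma tensor_lact_linl i j l (t : tensor_hom j l) :
  linear (fun a : A i j => tensor_lact a t).
Proof.
move=> c a b; have l0 d := linear_fun0 (@tensor_lact_linr i j l d).
elim/tensor_ind: t => [|m d v w t IH]; first by rewrite !l0 scaler0 addr0.
rewrite !tensor_lact_linr IH !tensor_lactE lact_linl tens_linl.
by rewrite !scalerDr !scalerA (mulrC c) addrACA.
Qed.

Lemma tensor_ract_linr i j l (t : tensor_hom i j) :
  linear (fun a : A j l => tensor_ract t a).
Proof.
move=> c a b; have r0 d := linear_fun0 (@tensor_ract_linl i j l d).
elim/tensor_ind: t => [|m d v w t IH]; first by rewrite !r0 scaler0 addr0.
rewrite !tensor_ract_linl IH !tensor_ractE ract_linr tens_linr.
by rewrite !scalerDr !scalerA (mulrC c) addrACA.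
Qed.

Lemma linear_id (M : lmodType k) : linear (fun x : M => x).
Proof. by []. Qed.

Lemma linear_comp (M N P : lmodType k) (g : N -> P) (f : M -> N) :
  linear g -> linear f -> linear (fun x => g (f x)).
Proof. by move=> gl fl c x y; rewrite fl gl. Qed.

Lemma tensor_lact1 i l (t : tensor_hom i l) : tensor_lact (idc A i) t = t.
Proof.
apply: (tensor_ext (@tensor_lact_linr _ _ _ _) (@linear_id _)) => j v w.
by rewrite tensor_lactE lact1.
Qed.

Lemma tensor_ract1 i l (t : tensor_hom i l) : tensor_ract t (idc A l) = t.
Proof.
apply: (tensor_ext (@tensor_ract_linl _ _ _ _) (@linear_id _)) => j v w.
by rewrite tensor_ractE ract1.
Qed.

Lemma tensor_lactA i j l m (a : A i j) (b : A j l) (t : tensor_hom l m) :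
  tensor_lact a (tensor_lact b t) = tensor_lact (comp a b) t.
Proof.
apply: (tensor_ext (linear_comp (@tensor_lact_linr _ _ _ _)
  (@tensor_lact_linr _ _ _ _)) (@tensor_lact_linr _ _ _ _)) => p v w.
by rewrite !tensor_lactE lactA.
Qed.

Lemma tensor_ractA i j l m (t : tensor_hom i j) (a : A j l) (b : A l m) :
  tensor_ract (tensor_ract t a) b = tensor_ract t (comp a b).
Proof.
apply: (tensor_ext (linear_comp (@tensor_ract_linl _ _ _ _)
  (@tensor_ract_linl _ _ _ _)) (@tensor_ract_linl _ _ _ _)) => p v w.
by rewrite !tensor_ractE ractA.
Qed.

Lemma tensor_lractA i j l m (a : A i j) (t : tensor_hom j l) (b : A l m) :
  tensor_ract (tensor_lact a t) b = tensor_lact a (tensor_ract t b).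
Proof.
apply: (tensor_ext (linear_comp (@tensor_ract_linl _ _ _ _)
  (@tensor_lact_linr _ _ _ _)) (linear_comp (@tensor_lact_linr _ _ _ _)
  (@tensor_ract_linl _ _ _ _))) => p v w.
by rewrite !(tensor_ractE, tensor_lactE).
Qed.

Definition tensor : bimod A :=
  @Bimod k I A tensor_hom tensor_lact tensor_ract tensor_lact_linl
    tensor_lact_linr tensor_ract_linl tensor_ract_linr tensor_lact1 tensor_ract1
    tensor_lactA tensor_ractA tensor_lractA.

End Tensor.

Section TensorMaps.
Variables (k : fieldType) (I : choiceType) (A : kcat k I).

(* tensor_lift is meaningful on balanced families only (tensor_liftE), which   *)
(* is the case of bimodule morphisms.                                          *)
Definition tensor_map (V W V' W' : bimod A) (f : forall i j, V i j -> V' i j)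
    (g : forall i j, W i j -> W' i j) i l : tensor V W i l -> tensor V' W' i l :=
  tensor_lift (fun j v w => tens (f i j v) (g j l w)).

Definition tensor_assoc (U V W : bimod A) i l :
    tensor (tensor U V) W i l -> tensor U (tensor V W) i l :=
  tensor_lift (fun j (t : tensor U V i j) (w : W j l) =>
    tensor_lift (fun m (u : U i m) (v : V m j) =>
      tens (W := tensor V W) u (tens v w)) t).

End TensorMaps.

Record box (k : fieldType) (I : choiceType) := Box {
  bcat : kcat k I;
  bbim : bimod bcat;
  mu : forall i j, bbim i j -> tensor bbim bbim i j;
  eps : forall i j, bbim i j -> bcat i j;
  mu_morph : bimod_morphism (W := tensor bbim bbim) mu;
  eps_morph : bimod_morphism (W := regular_bimod bcat) eps;
  mu_coassoc : forall i j (v : bbim i j),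
    tensor_assoc (tensor_map (V' := tensor bbim bbim) mu (fun _ _ w => w) (mu v))
    = tensor_map (W' := tensor bbim bbim) (fun _ _ w => w) mu (mu v);
  mu_counitl : forall i j (v : bbim i j),
    tensor_lift (fun l (x : bbim i l) (y : bbim l j) => lact (eps x) y) (mu v) = v;
  mu_counitr : forall i j (v : bbim i j),
    tensor_lift (fun l (x : bbim i l) (y : bbim l j) => ract x (eps y)) (mu v) = v }.

(* solid i j and dotted i j are the sets of arrows from j to i.                *)
Record biquiver (I : Type) := Biquiver {
  solid : I -> I -> finType;
  dotted : I -> I -> finType }.

(* bqpath Q d i j: the paths from j to i with exactly d dotted arrows, written *)
(* from right to left (the head constructor is the last arrow travelled).      *)
Inductive bqpath (I : Type) (Q : biquiver I) : nat -> I -> I -> Type :=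
| pnil i : bqpath Q 0 i i
| psolid d i m j : solid Q i m -> bqpath Q d m j -> bqpath Q d i j
| pdotted d i m j : dotted Q i m -> bqpath Q d m j -> bqpath Q d.+1 i j.
Arguments pnil {I Q} i.

HB.instance Definition _ I (Q : biquiver I) d i j := gen_eqMixin (bqpath Q d i j).
HB.instance Definition _ I (Q : biquiver I) d i j :=
  gen_choiceMixin (bqpath Q d i j).

(* The component of degree d of 1_i kQ 1_j.                                    *)
Definition pathmod (k : fieldType) (I : Type) (Q : biquiver I) d i j :=
  {malg k[bqpath Q d i j]}.

Fixpoint all_solid (I : Type) (Q : biquiver I)
    (P : forall i j, solid Q i j -> bool) d i j (p : bqpath Q d i j) : bool :=
  match p with
  | pnil _ => true
  | psolid _ _ _ _ a q => P _ _ a && all_solid P q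
  | pdotted _ _ _ _ _ q => all_solid P q
  end.

(* A differential is given by its values on the arrows, which determine its    *)
(* extension to kQ. When it comes from a box (see computes_differential), its  *)
(* square is zero by the axioms of a box.                                      *)
Record differential (k : fieldType) (I : Type) (Q : biquiver I) := Differential {
  dsolid : forall i j, solid Q i j -> pathmod k Q 1 i j;
  ddotted : forall i j, dotted Q i j -> pathmod k Q 2 i j }.

Definition solid_triangular (k : fieldType) (I : Type) (Q : biquiver I)
    (D : differential k Q) : Prop :=
  exists h : forall i j, solid Q i j -> nat,
    forall i j (a : solid Q i j) (p : bqpath Q 1 i j), p \in msupp (dsolid D a) ->
      all_solid (fun i' j' (b : solid Q i' j') => (h i' j' b < h i j a)%N) p.

Section Generators.
Variables (k : fieldType) (I : choiceType) (X : box k I) (Q : biquiver I).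
Let A := bcat X.
Let V := bbim X.

Fixpoint tpow (d : nat) : bimod A :=
  match d with
  | 0 => regular_bimod A
  | d'.+1 => match d' with 0 => V | _.+1 => tensor V (tpow d') end
  end.

Definition tpow_cons d i m j : V i m -> tpow d m j -> tpow d.+1 i j :=
  match d with
  | 0 => fun v (a : A m j) => ract v a
  | _.+1 => fun v t => tens v t
  end.

Variables (s : forall i j, solid Q i j -> A i j)
          (t : forall i j, dotted Q i j -> V i j).

Fixpoint path_val d i j (p : bqpath Q d i j) : tpow d i j :=
  match p with
  | pnil i => idc A i
  | psolid _ _ _ _ a q => lact (s a) (path_val q)
  | pdotted _ _ _ _ v q => tpow_cons (t v) (path_val q)
  end.

Definition pathmod_val d i j (x : pathmod k Q d i j) : tpow d i j :=
  malg_lift (@path_val d i j) x.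

Definition normal_section (w : forall i, V i i) : Prop :=
  forall i, eps (w i) = idc A i /\ mu (w i) = tens (w i) (w i).

Definition path_category : Prop := forall i j, bijective (@pathmod_val 0 i j).

(* As A is the path category of the solid arrows, the paths p v q with v       *)
(* dotted and p, q solid form a basis of the direct sum of the bimodules       *)
(* A1_l (x)_k 1_mA, one for each dotted arrow v from m to l.                   *)
Definition free_kernel : Prop :=
  [/\ forall i j (v : dotted Q i j), eps (t v) = 0,
      forall i j, injective (@pathmod_val 1 i j)
    & forall i j (v : V i j), eps v = 0 -> exists x, @pathmod_val 1 i j x = v].

Definition computes_differential (w : forall i, V i i) (D : differential k Q) :
    Prop :=
  (forall i j (a : solid Q i j),
     pathmod_val (dsolid D a) = ract (w i) (s a) - lact (s a) (w j)) /\
  (forall i j (v : dotted Q i j),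
     pathmod_val (ddotted D v) = mu (t v) - tens (t v) (w j) - tens (w i) (t v)).

End Generators.

Definition has_differential_biquiver (k : fieldType) (I : choiceType)
    (X : box k I) (Q : biquiver I) (D : differential k Q) : Prop :=
  exists (s : forall i j, solid Q i j -> bcat X i j)
         (t : forall i j, dotted Q i j -> bbim X i j)
         (w : forall i, bbim X i i),
  [/\ normal_section w, path_category s t, free_kernel s t
    & computes_differential s t w D].

Section BT.
Variables (k : fieldType) (I : finType) (Q : biquiver I).

(* The solid arrows from j to i outside the chosen set of loops.               *)
Definition nonloop (a : forall i, solid Q i i) i j :=
  {x : solid Q i j | Tagged (solid Q i) x != Tagged (solid Q i) (a i)}.

(* The sum of the (-1)^|x| x x~ over the arrows x of b^ ending at i: x runs    *)
(* over the solid arrows of b ending at i, and over the arrows y~ with y in b  *)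
(* starting at i.                                                              *)
Definition BT_sum (a : forall i, solid Q i i)
    (tilde : forall i j, nonloop a i j -> dotted Q j i) i : pathmod k Q 1 i i :=
  \sum_j \sum_(x : nonloop a i j)
    << psolid (val x) (pdotted (tilde i j x) (pnil i)) >>
  - \sum_j \sum_(y : nonloop a j i)
    << pdotted (tilde j i y) (psolid (val y) (pnil i)) >>.

(* Arrows with different endpoints are distinct, so that the injectivity of    *)
(* x |-> x~ can be stated for each pair of endpoints separately.               *)
Definition BT_differential (D : differential k Q) : Prop :=
  exists (a : forall i, solid Q i i)
         (tilde : forall i j, nonloop a i j -> dotted Q j i),
  (forall i j, injective (@tilde i j)) /\
  (forall i, dsolid D (a i) = BT_sum tilde i).

End BT.

Definition BT_type (k : fieldType) (I : finType) (X : box k I) : Prop :=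
  exists (Q : biquiver I) (D : differential k Q),
  [/\ has_differential_biquiver X D, solid_triangular D & BT_differential D].

Section Algebra.
Variables (k : fieldType) (L : falgType k).

Definition left_ideal (M : {vspace L}) : Prop := ({:L} * M <= M)%VS.

Definition maximal_left_ideal (M : {vspace L}) : Prop :=
  [/\ left_ideal M, M <> fullv
    & forall N : {vspace L}, left_ideal N -> (M <= N)%VS -> N = M \/ N = fullv].

(* The Jacobson radical; in a finite dimensional algebra every left ideal is a *)
(* subspace.                                                                   *)
Definition is_radical (R : {vspace L}) : Prop :=
  forall x, x \in R <-> (forall M, maximal_left_ideal M -> x \in M).

Definition idempotent (e : L) : Prop := e * e = e.

Definition primitive_idempotent (e : L) : Prop :=
  [/\ idempotent e, e <> 0
    & forall f g : L, idempotent f -> idempotent g -> f * g = 0 -> g * f = 0 ->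
        e = f + g -> f = 0 \/ g = 0].

Definition left_isomorphic (M N : {vspace L}) : Prop :=
  exists f : 'End(L), [/\ (f @: M)%VS = N, (M :&: lker f)%VS = 0%VS
    & forall a x, x \in M -> f (a * x) = a * f x].

Definition basic_decomposition n (e : 'I_n -> L) : Prop :=
  [/\ 1 = \sum_i e i,
      forall i, primitive_idempotent (e i),
      forall i j, i != j -> e i * e j = 0
    & forall i j, i != j ->
        ~ left_isomorphic ({:L} * <[e i]>)%VS ({:L} * <[e j]>)%VS].

Variables (n : nat) (e : 'I_n -> L) (R : {vspace L}).

Definition corner i j : {vspace L} := (<[e i]> * R * <[e j]>)%VS.

Variable B0 : forall i j, (\dim (corner i j)).-tuple L.

(* The set B(j,i): a basis element of e_i R e_j, or e_i if i = j.              *)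
Definition Bset i j : finType :=
  ('I_(\dim (corner i j)) + {_ : unit | i == j})%type.
Definition rad_index i j (b : 'I_(\dim (corner i j))) : Bset i j := inl b.
Definition Belt i j (b : Bset i j) : L :=
  match b with inl x => tnth (B0 i j) x | inr _ => e i end.

(* A product of elements of B can be nonzero only when they are composable,    *)
(* and then it lies in e_i L e_l.                                              *)
Definition structure_constants
    (gamma : forall i j l, Bset i j -> Bset j l -> Bset i l -> k) : Prop :=
  forall i j l (x : Bset i j) (y : Bset j l),
    Belt x * Belt y = \sum_(b : Bset i l) gamma i j l x y b *: Belt b.

(* The element b of the basis of e_i R e_j gives the dotted arrow b^* from i   *)
(* to j.                                                                       *)
Definition L_biquiver : biquiver 'I_n :=
  Biquiver Bset (fun i j => 'I_(\dim (corner j i)) : finType).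

Variable gamma : forall i j l, Bset i j -> Bset j l -> Bset i l -> k.

Definition star i j (b : 'I_(\dim (corner i j))) : dotted L_biquiver j i := b.

Definition L_dsolid i j (b : solid L_biquiver i j) : pathmod k L_biquiver 1 i j :=
  \sum_l \sum_(x : 'I_(\dim (corner j l))) \sum_(y : Bset i l)
    gamma b (rad_index x) y *:
      << psolid (y : solid L_biquiver i l) (pdotted (star x) (pnil j)) >>
  - \sum_l \sum_(y : 'I_(\dim (corner l i))) \sum_(x : Bset l j)
    gamma (rad_index y) b x *:
      << pdotted (star y) (psolid (x : solid L_biquiver l j) (pnil j)) >>.

(* The arrow v = b^* from j to i belongs to an element b of e_j R e_i.         *)
Definition L_ddotted i j (b : dotted L_biquiver i j) : pathmod k L_biquiver 2 i j :=
  \sum_l \sum_(x : 'I_(\dim (corner j l))) \sum_(y : 'I_(\dim (corner l i)))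
    gamma (rad_index x) (rad_index y) (rad_index b) *:
      << pdotted (star y) (pdotted (star x) (pnil j)) >>.

Definition L_differential : differential k L_biquiver :=
  Differential L_dsolid L_ddotted.

End Algebra.

(* Main.v *)
From HB Require Import structures.
Require Import Defs.
From mathcomp Require Import all_boot all_algebra falgebra.
From mathcomp Require Import finmap.
From mathcomp.classical Require Import boolp.
From mathcomp.multinomials Require Import monalg.

Set Implicit Arguments.
Unset Strict Implicit.
Unset Printing Implicit Defensive.

Import GRing.Theory.
Local Open Scope ring_scope.

(** The shape required of a BT-type differential holds for every choice of the
    bases of the spaces e_i R e_j: the loops are the idempotents e_i, and b~ is
    the dotted arrow b' dual to b.  Indeed e_i b = b for b in e_i R e_l, so that in
      d(e_i) = sum gamma(e_i,x,y) y x' - sum gamma(y,e_i,x) y' x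
    only the terms with x = y remain (idem_loop_differential).

    Solid-triangularity, on the other hand, depends on the bases.  A solid arrow
    that occurs in d(b) is a basis element that occurs in a product b x or y b
    with x, y in the radical R.  As R is nilpotent (radical_nilpotent), such a
    product is strictly deeper than b in the filtration L > R > R^2 > ... > 0.
    When every term of the filtration of e_i R e_j is spanned by the basis
    elements that it contains (adapted_frame), all basis elements occurring in
    the product are deeper too, and counting the terms that do not contain b is
    a height function (L_solid_triangular).

    It remains to pass from the given bases to adapted ones
    (L_box_basis_independent).  The values s(b), t(b') of the arrows in the box
    are transformed by a base change and by the dual base change.  On the one
    hand, a linear substitution of the arrows that has an inverse induces a
    bijection of the path modules, so that freeness is preserved
    (path_category_subst, free_kernel_subst).  On the other hand, extending s
    linearly to elements of L, the differential reads
      d(u) = sum_x s(u x) t(x') - sum_y t(y') s(y u),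
      d(f) = sum_{x,y} f(x y) t(y') (x) t(x')
    for elements u and linear forms f; the right-hand sides involve the bases
    only through the canonical elements sum_x x (x) x', hence do not depend on
    them (new_dotted_dual). *)

(** * The radical of a finite dimensional algebra *)

Section Radical.
Variables (k : fieldType) (L : falgType k).
Implicit Types (M N K R : {vspace L}).

Lemma left_idealP M : left_ideal M <-> (forall a x, x \in M -> a * x \in M).
Proof.
split=> [/prodvP lM a x xM|lM]; first by apply: lM; rewrite ?memvf.
by apply/prodvP => a x _; apply: lM.
Qed.

(** M / N is a simple module, M being understood to be a left ideal. *)
Definition simple_quotient N M : Prop :=
  [/\ left_ideal N, (N <= M)%VS, N <> M
    & forall K, left_ideal K -> (N <= K)%VS -> (K <= M)%VS -> K = N \/ K = M].

(** Among the left ideals between N and M and different from M, one of maximal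
    dimension has the required property; the induction is on the codimension. *)
Lemma exists_simple_quotient N M : left_ideal N -> (N <= M)%VS -> N <> M ->
  exists2 K, (N <= K)%VS & simple_quotient K M.
Proof.
move eq_d: (\dim M - \dim N)%N => d.
elim/ltn_ind: d N eq_d => d IH N eq_d lN sNM neNM.
have [[K [lK sNK sKM [neKN neKM]]]|noK] := pselect (exists K,
    [/\ left_ideal K, (N <= K)%VS, (K <= M)%VS & K <> N /\ K <> M]).
  have ltNK : (\dim N < \dim K)%N.
    by rewrite ltn_neqAle dimvS // andbT; apply/eqP=> /eqP eqd; apply: neKN;
       apply/esym/eqP; rewrite eqEdim sNK /= (eqP eqd).
  have leKM := dimvS sKM.
  have [] := IH (\dim M - \dim K)%N _ K erefl lK sKM neKM.
    by rewrite -eq_d ltn_sub2l // (leq_trans ltNK).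
  by move=> K' sKK' sK'; exists K' => //; apply: subv_trans sKK'.
exists N => //; split=> // K lK sNK sKM.
have [->|neKN] := eqVneq K N; first by left.
have [->|neKM] := eqVneq K M; first by right.
by case: noK; exists K; split=> //; split; apply/eqP.
Qed.

Variable R : {vspace L}.
Hypothesis radR : is_radical R.

Lemma radical_left_ideal : left_ideal R.
Proof.
apply/left_idealP => a x /radR xR; apply/radR => M maxM.
by have [/left_idealP lM _ _] := maxM; apply/lM/xR.
Qed.

(** The radical annihilates simple modules: if m in M is not in N, then
    K = {a | a m in N} is the kernel of the surjection a |-> a m from L onto
    M / N, thus a maximal left ideal, and it contains R.  Both the two-sidedness
    of R (with M = L) and its nilpotency (with M a power of R) follow from
    this. *)
Lemma radical_simple_quotient N M : left_ideal M -> simple_quotient N M ->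
  (R * M <= N)%VS.
Proof.
move=> lM [lN sNM neNM simple]; apply/prodvP => r m rR mM.
have [mN|mN] := boolP (m \in N); first by move/left_idealP: lN; apply.
have lM' := (left_idealP M).1 lM; have lN' := (left_idealP N).1 lN.
pose K := (amulr m @^-1: N)%VS.
have KE a : (a \in K) = (a * m \in N) by rewrite -memv_preim lfunE.
suff maxK : maximal_left_ideal K by rewrite -KE; apply: (radR r).1.
split.
- by apply/left_idealP => a x; rewrite !KE -mulrA; apply: lN'.
- by move=> Kf; have := memvf (1 : L); rewrite -Kf KE mul1r (negPf mN).
move=> K' lK' sKK'; have lK'' := (left_idealP K').1 lK'.
(* K' <[m]> + N lies between N and M, and decides whether K' is K or L. *)
have lKm : left_ideal (K' * <[m]> + N)%VS.
  rewrite /left_ideal prodvDr subv_add; apply/andP; split.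
    by apply: subv_trans (addvSl _ _); rewrite prodvA prodvSl.
  exact: subv_trans lN (addvSr _ _).
have [| |eqN|eqM] := simple _ lKm; first exact: addvSr.
- rewrite subv_add sNM andbT; apply/prodvP => a _ _ /vlineP[c ->].
  by rewrite lM' // memvZ.
- left; apply/eqP; rewrite eqEsubv sKK' andbT; apply/subvP => a aK'.
  rewrite KE -eqN; apply: (subvP (addvSl _ _)).
  by rewrite memv_mul ?memv_line.
right; have : m \in (K' * <[m]> + N)%VS by rewrite eqM.
case/memv_addP => u uK' [v vN eqm].
have sub1 : 1 \in K'.
  have [a aK' eqa] : exists2 a, a \in K' & u = a * m.
    by move: uK'; rewrite -limg_amulr => /memv_imgP[a aK' ->]; exists a;
       rewrite ?lfunE.
  rewrite -(subrK a 1) memvD // (subvP sKK') // KE mulrBl mul1r.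
  by rewrite {1}eqm eqa addrC addKr.
apply/eqP; rewrite eqEsubv subvf /=; apply/subvP => a _.
by rewrite -[a]mulr1 lK''.
Qed.

Lemma radical_right_ideal : (R * {:L} <= R)%VS.
Proof.
apply/subvP => x xRL; apply/radR => M [lM neM maxM].
apply: (subvP _ _ xRL); apply: radical_simple_quotient; first exact: subvf.
by split=> //; [exact: subvf | move=> K lK sMK _; apply: maxM].
Qed.

(** If f is not 0, then L (1 - f) is a proper left ideal, as it is annihilated
    by f on the right; a maximal left ideal containing it contains f and
    1 - f. *)
Lemma radical_idempotent f : f * f = f -> f \in R -> f = 0.
Proof.
move=> ff fR; apply/eqP/negPn/negP => f_neq0.
pose N := ({:L} * <[1 - f]>)%VS.
have fN x : x \in N -> x * f = 0.
  suff sN : (N <= lker (amulr f))%VS.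
    by move/(subvP sN); rewrite memv_ker lfunE => /eqP.
  apply/prodvP => a _ _ /vlineP[c ->].
  by rewrite memv_ker lfunE /= -!scalerAr -scalerAl -mulrA mulrBl mul1r ff
    subrr mulr0 scaler0.
have lN : left_ideal N by rewrite /left_ideal prodvA prodvSl ?subvf.
have [|M sNM [lM _ neM maxM]] := exists_simple_quotient lN (subvf N).
  move=> Nf; case/eqP: f_neq0; rewrite -[f]mul1r; apply: fN.
  by rewrite Nf memvf.
have mM : maximal_left_ideal M.
  by split=> // K lK sMK; apply: maxM; rewrite ?subvf.
apply: neM; apply/eqP; rewrite eqEsubv subvf; apply/subvP => a _.
rewrite -[a]mulr1; apply: ((left_idealP M).1 lM).
have fM : f \in M by apply: (radR f).1.
have gM : 1 - f \in M.
  by apply: (subvP sNM); rewrite -[1 - f]mul1r; apply: memv_mul;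
     [exact: memvf | exact: memv_line].
by rewrite -(subrK f 1); apply: memvD.
Qed.

(** The powers of R as left ideals; starting from L rather than from the line
    of 1 makes the 0-th term of the filtration the whole algebra. *)
Definition radical_power m : {vspace L} := iter m (prodv R) fullv.

Lemma radical_power_left_ideal m : left_ideal (radical_power m).
Proof.
case: m => [|m]; first exact: subvf.
by rewrite /left_ideal prodvA prodvSl // radical_left_ideal.
Qed.

Lemma radical_power1 : radical_power 1 = R.
Proof.
apply/eqP; rewrite eqEsubv radical_right_ideal; apply/subvP => x xR.
by rewrite -[x]mulr1 memv_mul ?memvf.
Qed.

Lemma radical_powerS m : (radical_power m.+1 <= radical_power m)%VS.
Proof. by elim: m => [|m IH]; rewrite ?subvf ?prodvSr. Qed.

Lemma radical_power_mulr m : (radical_power m * R <= radical_power m.+1)%VS.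
Proof.
elim: m => [|m IH]; last by rewrite /= -prodvA prodvSr.
by rewrite radical_power1 radical_left_ideal.
Qed.

(** As long as M = R^m is not 0, it has a simple quotient M / N, and
    R M <= N < M: the dimension decreases at each step. *)
Lemma radical_nilpotent : radical_power (\dim {:L}) = 0%VS.
Proof.
suff dimP m : (\dim (radical_power m) <= \dim {:L} - m)%N.
  by apply/eqP; rewrite -dimv_eq0 -leqn0 (leq_trans (dimP _)) ?subnn.
elim: m => [|m IH]; first by rewrite subn0.
have [P0|Pn0] := eqVneq (radical_power m) 0%VS.
  by rewrite /radical_power iterS -/(radical_power m) P0 prodv0 dimv0.
have l0 : left_ideal (0 : {vspace L})%VS by rewrite /left_ideal prodv0 subvv.
have [|N _ sN] := exists_simple_quotient l0 (sub0v (radical_power m)).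
  by apply/eqP; rewrite eq_sym.
have sRN := radical_simple_quotient (radical_power_left_ideal m) sN.
case: sN => _ sNM neNM _.
rewrite subnS -ltnS prednK.
  apply: leq_ltn_trans (dimvS sRN) _; apply: leq_trans IH.
  rewrite ltn_neqAle dimvS // andbT; apply: contra_notN neNM => /eqP eqd.
  by apply/eqP; rewrite eqEdim sNM eqd /=.
apply: leq_trans IH; rewrite lt0n dimv_eq0 //.
Qed.

End Radical.

(** * Bases adapted to a filtration *)

Section AdaptedBasis.
Variables (k : fieldType) (V : vectType k).

(** Starting from the last term of the chain, a basis of U (m + 1) is completed
    to a basis of U m by a basis of a complement. *)
Lemma adapted_basis N (U : nat -> {vspace V}) :
    (forall m, (U m.+1 <= U m)%VS) -> U N = 0%VS ->
  exists2 s : seq V, basis_of (U 0) s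
    & forall m, (U m <= <<[seq x <- s | x \in U m]>>)%VS.
Proof.
elim: N U => [|N IH] U decU UN.
  exists [::] => [|m]; first by rewrite UN basisEfree nil_free span_nil sub0v dimv0.
  rewrite span_nil -UN; elim: m => // m; exact: subv_trans (decU m).
have [s bs sU] := IH (fun m => U m.+1) (fun m => decU m.+1) UN.
have [C bC] : exists C : seq V, basis_of (U 0%N :\: U 1%N) C.
  by exists (vbasis (U 0%N :\: U 1%N)); apply: vbasisP.
have bCs : basis_of (U 0) (C ++ s).
  have <- : (U 0%N :\: U 1%N + U 1%N)%VS = U 0.
    by rewrite -[X in (_ + X)%VS](capv_idPr (decU 0)) addv_diff_cap.
  by apply: cat_basis => //; exact/directv_addP/capv_diff.
exists (C ++ s) => // -[|m].
  suff /all_filterP-> : all (mem (U 0)) (C ++ s) by rewrite (span_basis bCs).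
  by apply/allP => x; apply: (basis_mem bCs).
by rewrite filter_cat span_cat (subv_trans (sU m)) // addvSr.
Qed.

End AdaptedBasis.

(** * Linear maps given by a predicate *)

Section Linear.
Variables (k : fieldType) (M N : lmodType k) (f : M -> N).
Hypothesis fl : linear f.

Lemma linear_eq0 : f 0 = 0. Proof. exact: linear_fun0 fl. Qed.

Lemma linear_eqZ c u : f (c *: u) = c *: f u.
Proof. by rewrite -[c *: u]addr0 fl linear_eq0 addr0. Qed.

Lemma linear_eqB u v : f (u - v) = f u - f v.
Proof. by rewrite addrC -scaleN1r fl scaleN1r addrC. Qed.

Lemma linear_eq_sum (T : Type) (r : seq T) (P : pred T) (u : T -> M) :
  f (\sum_(x <- r | P x) u x) = \sum_(x <- r | P x) f (u x).
Proof.
apply: (big_morph f _ linear_eq0) => x y.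
by rewrite -[x]scale1r fl !scale1r.
Qed.

Lemma linear_eq_sumZ (T : Type) (r : seq T) (P : pred T) (c : T -> k)
    (u : T -> M) :
  f (\sum_(x <- r | P x) c x *: u x) = \sum_(x <- r | P x) c x *: f (u x).
Proof. by rewrite linear_eq_sum; under eq_bigr do rewrite linear_eqZ. Qed.

End Linear.

Lemma linear_scale_sum (k : fieldType) (M N : lmodType k) (T : finType)
    (c : T -> k) (f : T -> M -> N) :
  (forall b, linear (f b)) -> linear (fun u => \sum_b c b *: f b u).
Proof.
move=> fl a u v; rewrite scaler_sumr -big_split /=; apply: eq_bigr => b _.
by rewrite fl scalerDr !scalerA mulrC.
Qed.

Lemma linear_form_sumZ (k : fieldType) (M : lmodType k) (T : Type) (r : seq T)
    (P : pred T) (c : T -> k) (u : T -> M) (f : M -> k) :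
    linear (f : M -> k^o) ->
  f (\sum_(x <- r | P x) c x *: u x) = \sum_(x <- r | P x) c x * f (u x).
Proof. by move=> fl; apply: (linear_eq_sumZ fl). Qed.

Lemma linear_sum_scale (k : fieldType) (M N : lmodType k) (T : finType)
    (g : T -> M -> k) (w : T -> N) :
  (forall b, linear (g b : M -> k^o)) -> linear (fun u => \sum_b g b u *: w b).
Proof.
move=> gl c u v; rewrite scaler_sumr -big_split /=; apply: eq_bigr => b _.
by rewrite gl scalerDl scalerA.
Qed.

Lemma malg_linear_ext (k : nzRingType) (T : choiceType) (X : lmodType k)
    (f g : {malg k[T]} -> X) :
  linear f -> linear g -> (forall p, f << p >> = g << p >>) -> f =1 g.
Proof.
move=> fl gl fg u.
pose F : {linear _ -> _} := HB.pack f (GRing.isLinear.Build _ _ _ _ f fl).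
pose G : {linear _ -> _} := HB.pack g (GRing.isLinear.Build _ _ _ _ g gl).
rewrite -[f]/(F : _ -> _) -[g]/(G : _ -> _) [u]monalgE !linear_sum.
apply: eq_bigr => p _.
have -> : << u@_p *g p >> = u@_p *: << p >>.
  by apply/malgP => q; rewrite mcoeffZ !mcoeffU mulr_natr.
by rewrite !linearZ /= fg.
Qed.

(** * Linear substitutions of the arrows of a biquiver *)

Section Substitution.
Variables (k : fieldType) (I : choiceType) (Q : biquiver I).

Definition solid_mx := forall i j, solid Q i j -> solid Q i j -> k.
Definition dotted_mx := forall i j, dotted Q i j -> dotted Q i j -> k.

(** Composition with an arrow on the left, as a linear map between path
    modules; paths are formal, so this is defined on the basis of paths. *)
Definition cons_solid d i m j (a : solid Q i m) :
    pathmod k Q d m j -> pathmod k Q d i j :=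
  malg_lift (fun p => << psolid a p >>).
Definition cons_dotted d i m j (v : dotted Q i m) :
    pathmod k Q d m j -> pathmod k Q d.+1 i j :=
  malg_lift (fun p => << pdotted v p >>).

(** The image of a path under the algebra endomorphism of kQ that sends the
    solid arrow a to sum_b S a b b and the dotted arrow v to sum_w T v w w. *)
Fixpoint path_subst (S : solid_mx) (T : dotted_mx) d i j (p : bqpath Q d i j) :
    pathmod k Q d i j :=
  match p with
  | pnil i => << pnil i >>
  | psolid _ _ _ _ a q => \sum_b S _ _ a b *: cons_solid b (path_subst S T q)
  | pdotted _ _ _ _ v q => \sum_w T _ _ v w *: cons_dotted w (path_subst S T q)
  end.

Definition pathmod_subst S T d i j : pathmod k Q d i j -> pathmod k Q d i j :=
  malg_lift (@path_subst S T d i j).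

Lemma sum_delta (T : finType) (M : lmodType k) (a : T) (u : T -> M) :
  \sum_c (a == c)%:R *: u c = u a.
Proof.
rewrite (bigD1 a) //= eqxx scale1r big1 ?addr0 // => c /negPf.
by rewrite eq_sym => ->; rewrite scale0r.
Qed.

Lemma sum_inverse (T : finType) (M : lmodType k) (S S' : T -> T -> k) (a : T)
    (u : T -> M) :
  (forall a c, \sum_b S a b * S' b c = (a == c)%:R) ->
  \sum_b S a b *: (\sum_c S' b c *: u c) = u a.
Proof.
move=> SS'; rewrite -[RHS](sum_delta a u).
under eq_bigr do rewrite scaler_sumr.
rewrite exchange_big; apply: eq_bigr => c _.
by rewrite -SS' scaler_suml; apply: eq_bigr => b _; rewrite scalerA.
Qed.

Lemma pathmod_subst_linear S T d i j : linear (@pathmod_subst S T d i j).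
Proof. exact: malg_lift_linear. Qed.

Lemma pathmod_subst_cons_solid S T d i m j (a : solid Q i m)
    (u : pathmod k Q d m j) :
  pathmod_subst S T (cons_solid a u)
    = \sum_b S _ _ a b *: cons_solid b (pathmod_subst S T u).
Proof.
move: u; apply: malg_linear_ext => [||p].
- exact: linear_comp (malg_lift_linear _) (malg_lift_linear _).
- apply: linear_scale_sum => b.
  exact: linear_comp (malg_lift_linear _) (malg_lift_linear _).
by rewrite /cons_solid /pathmod_subst !malg_liftU.
Qed.

Lemma pathmod_subst_cons_dotted S T d i m j (v : dotted Q i m)
    (u : pathmod k Q d m j) :
  pathmod_subst S T (cons_dotted v u)
    = \sum_w T _ _ v w *: cons_dotted w (pathmod_subst S T u).
Proof.
move: u; apply: malg_linear_ext => [||p].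
- exact: linear_comp (malg_lift_linear _) (malg_lift_linear _).
- apply: linear_scale_sum => b.
  exact: linear_comp (malg_lift_linear _) (malg_lift_linear _).
by rewrite /cons_dotted /pathmod_subst !malg_liftU.
Qed.

(** The composite of two substitutions is multiplicative, so that it is the
    identity as soon as it fixes the arrows, which is what the matrix identities
    say. *)
Lemma pathmod_substK (S S' : solid_mx) (T T' : dotted_mx) d i j :
    (forall i j a c, \sum_b S i j a b * S' i j b c = (a == c)%:R) ->
    (forall i j a c, \sum_b T i j a b * T' i j b c = (a == c)%:R) ->
  cancel (@pathmod_subst S T d i j) (@pathmod_subst S' T' d i j).
Proof.
move=> SS' TT'; apply: malg_linear_ext => [||p].
- exact: linear_comp (malg_lift_linear _) (malg_lift_linear _).
- exact: linear_id.
rewrite {2}/pathmod_subst malg_liftU.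
elim: p => {d i j} [i|d i m j a q IH|d i m j v q IH] /=.
- by rewrite /pathmod_subst malg_liftU.
- rewrite (linear_eq_sumZ (@pathmod_subst_linear _ _ _ _ _)).
  under eq_bigr do rewrite pathmod_subst_cons_solid IH.
  by rewrite sum_inverse // /cons_solid malg_liftU.
- rewrite (linear_eq_sumZ (@pathmod_subst_linear _ _ _ _ _)).
  under eq_bigr do rewrite pathmod_subst_cons_dotted IH.
  by rewrite sum_inverse // /cons_dotted malg_liftU.
Qed.

End Substitution.

(** * Linear changes of free generators of a box *)

Section ChangeOfGenerators.
Variables (k : fieldType) (I : choiceType) (X : box k I) (Q : biquiver I).
Variables (s : forall i j, solid Q i j -> bcat X i j)
          (t : forall i j, dotted Q i j -> bbim X i j).

Lemma tpow_cons_linl d i m j (u : tpow X d m j) :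
  linear (fun v : bbim X i m => tpow_cons v u).
Proof.
by case: d u => [|d] u c v w /=; [rewrite ract_linl | rewrite tens_linl].
Qed.

Lemma tpow_cons_linr d i m j (v : bbim X i m) :
  linear (fun u : tpow X d m j => tpow_cons v u).
Proof.
by case: d => [|d] c u w /=; [rewrite ract_linr | rewrite tens_linr].
Qed.

Lemma pathmod_val_linear d i j :
  linear (@pathmod_val k I X Q s t d i j).
Proof. exact: malg_lift_linear. Qed.

Lemma pathmod_val_cons_solid d i m j (a : solid Q i m) (u : pathmod k Q d m j) :
  pathmod_val s t (cons_solid a u) = lact (s a) (pathmod_val s t u).
Proof.
move: u; apply: malg_linear_ext => [||p].
- exact: linear_comp (malg_lift_linear _) (malg_lift_linear _).
- exact: linear_comp (lact_linr _) (malg_lift_linear _).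
by rewrite /cons_solid /pathmod_val !malg_liftU.
Qed.

Lemma pathmod_val_cons_dotted d i m j (v : dotted Q i m)
    (u : pathmod k Q d m j) :
  pathmod_val s t (cons_dotted v u) = tpow_cons (t v) (pathmod_val s t u).
Proof.
move: u; apply: malg_linear_ext => [||p].
- exact: linear_comp (malg_lift_linear _) (malg_lift_linear _).
- exact: linear_comp (@tpow_cons_linr _ _ _ _ _) (malg_lift_linear _).
by rewrite /cons_dotted /pathmod_val !malg_liftU.
Qed.

Variables (S S' : solid_mx k Q) (T T' : dotted_mx k Q).
Variables (s' : forall i j, solid Q i j -> bcat X i j)
          (t' : forall i j, dotted Q i j -> bbim X i j).
Hypothesis sE : forall i j (a : solid Q i j), s' a = \sum_b S a b *: s b.
Hypothesis tE : forall i j (v : dotted Q i j), t' v = \sum_w T v w *: t w.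

(** Evaluating a path at the new generators is evaluating its substitution at
    the old ones; so the bijectivity properties that define freeness pass from
    s, t to s', t' through the bijection of the path modules. *)
Lemma pathmod_val_subst d i j (u : pathmod k Q d i j) :
  pathmod_val s' t' u = pathmod_val s t (pathmod_subst S T u).
Proof.
move: u; apply: malg_linear_ext => [||p].
- exact: malg_lift_linear.
- exact: linear_comp (malg_lift_linear _) (malg_lift_linear _).
rewrite {1}/pathmod_val /pathmod_subst !malg_liftU.
elim: p => {d i j} [i|d i m j a q IH|d i m j v q IH] /=.
- by rewrite /pathmod_val malg_liftU.
- rewrite (linear_eq_sumZ (@pathmod_val_linear _ _ _)) IH sE.
  rewrite (linear_eq_sumZ (lact_linl _)); apply: eq_bigr => b _.
  by rewrite pathmod_val_cons_solid.
- rewrite (linear_eq_sumZ (@pathmod_val_linear _ _ _)) IH tE.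
  rewrite (linear_eq_sumZ (tpow_cons_linl _)); apply: eq_bigr => b _.
  by rewrite pathmod_val_cons_dotted.
Qed.

Hypothesis SS' : forall i j (a c : solid Q i j),
  \sum_b S a b * S' b c = (a == c)%:R.
Hypothesis S'S : forall i j (a c : solid Q i j),
  \sum_b S' a b * S b c = (a == c)%:R.
Hypothesis TT' : forall i j (v x : dotted Q i j),
  \sum_w T v w * T' w x = (v == x)%:R.
Hypothesis T'T : forall i j (v x : dotted Q i j),
  \sum_w T' v w * T w x = (v == x)%:R.

Lemma path_category_subst : path_category s t -> path_category s' t'.
Proof.
move=> bij i j.
have bijST : bijective (@pathmod_val _ _ _ _ s t 0 i j \o @pathmod_subst _ _ _ S T 0 i j).
  apply: bij_comp; first exact: bij.
  by exists (@pathmod_subst _ _ _ S' T' 0 i j); apply: pathmod_substK.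
by apply: (eq_bij bijST) => u; rewrite /= pathmod_val_subst.
Qed.

Lemma free_kernel_subst : free_kernel s t -> free_kernel s' t'.
Proof.
have [epsl _ _] := eps_morph X.
case=> eps0 inj surj; split=> [i j v|i j u v|i j v ev0].
- rewrite tE (linear_eq_sumZ (epsl i j)) big1 // => w _.
  by rewrite eps0 scaler0.
- rewrite !pathmod_val_subst => /inj.
  by apply: can_inj; apply: pathmod_substK SS' TT'.
have [x <-] := surj i j v ev0.
exists (pathmod_subst S' T' x).
by rewrite pathmod_val_subst (pathmod_substK S'S T'T).
Qed.

End ChangeOfGenerators.

(** * Coordinates in a free family *)

Section FreeFamily.
Variables (k : fieldType) (V : vectType k) (T : finType) (f : T -> V).

(** Coordinates are extended to the whole space, so that they can be applied to
    any element and composed as linear forms. *)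
Definition fcoord (b : T) : V -> k := coord (codom_tuple f) (enum_rank b).

HB.instance Definition _ b := GRing.Linear.on (fcoord b).

Lemma codom_tupleE b : (codom_tuple f)`_(enum_rank b) = f b.
Proof. by rewrite (nth_codom _ _ (enum_rank b)) enum_rankK. Qed.

Lemma free_codomP :
  (forall c : T -> k, \sum_b c b *: f b = 0 -> forall b, c b = 0) ->
  free (codom f).
Proof.
move=> f_free; apply/(freeP (X := codom_tuple f)) => c sum0 i.
rewrite -[i]enum_valK; apply: (f_free (c \o enum_rank)).
rewrite -[RHS]sum0 [RHS](reindex enum_rank); last first.
  exact: onW_bij (enum_rank_bij T).
by apply: eq_bigr => b _; rewrite codom_tupleE.
Qed.

Lemma fcoord_free b c : free (codom f) -> fcoord b (f c) = (b == c)%:R.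
Proof.
move=> f_free; rewrite -codom_tupleE /fcoord (coord_free _ _ f_free).
by rewrite eq_sym (inj_eq (@enum_rank_inj T)).
Qed.

Lemma fcoord_span v : v \in <<codom f>>%VS -> v = \sum_b fcoord b v *: f b.
Proof.
move=> /(coord_span (X := codom_tuple f)) {1}->.
rewrite (reindex enum_rank); last exact: onW_bij (enum_rank_bij T).
by apply: eq_bigr => b _; rewrite codom_tupleE.
Qed.

End FreeFamily.

(** * Bases of the corners and multiplication tables *)

Section Bases.
Variables (k : fieldType) (L : falgType k) (n : nat) (e : 'I_n -> L).
Variable R : {vspace L}.
Hypothesis eNcorner : forall i, e i \notin corner e R i i.

Local Notation frame := (forall i j, (\dim (corner e R i j)).-tuple L).

Definition is_frame (B : frame) := forall i j, basis_of (corner e R i j) (B i j).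

Definition bcoord (B : frame) i j (b : Bset e R i j) : L -> k :=
  fcoord (@Belt k L n e R B i j) b.

HB.instance Definition _ B i j b := GRing.Linear.on (@bcoord B i j b).

(** The only thing to check beyond the freeness of the basis of e_i R e_j is
    that e_i is not a combination of it when i = j, and this is the hypothesis
    on e. *)
Lemma Belt_free B i j : is_frame B -> free (codom (@Belt k L n e R B i j)).
Proof.
move=> frameB; apply: free_codomP => c; rewrite big_sumType /=.
set r := (X in X + _ = _); set u := (X in _ + X = _) => sum0.
have rR : r \in corner e R i j.
  apply: memv_suml => x _; apply: memvZ.
  by rewrite (basis_mem (frameB i j)) // mem_tnth.
have c0 x : c (inr x) = 0.
  (* An index inr x exists only if i = j, and then it is unique. *)
  have eqij := eqP (valP x); move: (x) (c) @u @r sum0 rR.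
  case: _ / eqij => {}x {}c u r sum0 rR; apply: contraNeq (eNcorner i) => cx0.
  have -> : e i = - (c (inr x))^-1 *: r.
    have -> : r = - (c (inr x) *: e i).
      apply/eqP; rewrite -addr_eq0 -[X in _ == X]sum0 /u (bigD1 x) //=.
      rewrite big1 ?addr0 // => -[[] y]; rewrite -val_eqE; by case: (val x).
    by rewrite scaleNr scalerN opprK scalerA mulVf // scale1r.
  exact: memvZ.
case=> [x|//]; move: sum0; rewrite {rR}/u [X in _ + X]big1; last first.
  by move=> y _; rewrite c0 scale0r.
rewrite addr0 /r => sum0.
apply: (freeP (basis_free (frameB i j)) (c \o inl)).
by rewrite -[RHS]sum0; apply: eq_bigr => y _; rewrite (tnth_nth 0).
Qed.

Lemma bcoord_Belt B i j (b c : Bset e R i j) :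
  is_frame B -> bcoord B b (Belt B c) = (b == c)%:R.
Proof. by move=> frameB; apply/fcoord_free/Belt_free. Qed.

Definition bspan (B : frame) i j := <<codom (@Belt k L n e R B i j)>>%VS.

Lemma mem_bspan B i j (b : Bset e R i j) : Belt B b \in bspan B i j.
Proof. by rewrite memv_span // codom_f. Qed.

Lemma bcoord_sum B i j u :
  u \in bspan B i j -> u = \sum_(b : Bset e R i j) bcoord B b u *: Belt B b.
Proof. exact: fcoord_span. Qed.

Lemma bcoord_uniq B i j (c : Bset e R i j -> k) b : is_frame B ->
  bcoord B b (\sum_x c x *: Belt B x) = c b.
Proof.
move=> frameB; rewrite linear_sum /= (bigD1 b) //= linearZ /= bcoord_Belt //.
rewrite eqxx mulr1 big1 ?addr0 // => x /negPf xb.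
by rewrite linearZ /= bcoord_Belt // eq_sym xb mulr0.
Qed.

Lemma corner_bspan B i j : is_frame B -> (corner e R i j <= bspan B i j)%VS.
Proof.
move=> frameB; rewrite -(span_basis (frameB i j)); apply/span_subvP => x.
by case/tnthP=> y ->; apply: (mem_bspan B (rad_index y)).
Qed.

Lemma Belt_bspan B B' i j (b : Bset e R i j) : is_frame B -> is_frame B' ->
  Belt B b \in bspan B' i j.
Proof.
move=> frameB frameB'; case: b => [x|y]; last exact: (mem_bspan B' (inr y)).
apply: (subvP (corner_bspan i j frameB')).
by rewrite (basis_mem (frameB i j)) // mem_tnth.
Qed.

Lemma bspan_eq B B' i j : is_frame B -> is_frame B' ->
  bspan B i j = bspan B' i j.
Proof.
move=> fB fB'; apply/eqP; rewrite eqEsubv.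
by apply/andP; split; apply/span_subvP => x /codomP[b ->]; apply: Belt_bspan.
Qed.

Lemma bcoord_corner_sum B i j u : is_frame B -> u \in corner e R i j ->
  u = \sum_x bcoord B (rad_index x) u *: Belt B (@rad_index k L n e R i j x).
Proof.
move=> frameB uR.
rewrite {1}(coord_basis (frameB i j) uR); apply: eq_bigr => x _.
rewrite /= (tnth_nth 0); congr (_ *: _).
rewrite {2}(coord_basis (frameB i j) uR) linear_sum /= (bigD1 x) //=.
have xE (y : 'I_(\dim (corner e R i j))) : (B i j)`_y = Belt B (@rad_index k L n e R i j y).
  by rewrite /= (tnth_nth 0).
rewrite linearZ /= xE bcoord_Belt // eqxx mulr1 big1 ?addr0 // => y /negPf yx.
rewrite linearZ /= xE bcoord_Belt // /rad_index.
by rewrite -[inl x == _]/(x == y) eq_sym yx mulr0.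
Qed.

Lemma structure_constantsE B (gamma : forall i j l : 'I_n,
    Bset e R i j -> Bset e R j l -> Bset e R i l -> k) i j l
    (x : Bset e R i j) (y : Bset e R j l) (b : Bset e R i l) :
  is_frame B -> structure_constants B gamma ->
  gamma i j l x y b = bcoord B b (Belt B x * Belt B y).
Proof. by move=> fB gammaE; rewrite gammaE bcoord_uniq. Qed.

Definition multiplication_table (B : frame) i j l (x : Bset e R i j)
    (y : Bset e R j l) (b : Bset e R i l) : k :=
  bcoord B b (Belt B x * Belt B y).

(** A multiplication table for one frame shows that the span of the elements
    Belt B0 b is closed under products; this span is the same for all frames. *)
Lemma multiplication_tableP B0 gamma B :
  is_frame B0 -> structure_constants B0 gamma -> is_frame B ->
  structure_constants B (multiplication_table B).
Proof.
move=> fB0 gammaE fB i j l x y; apply: bcoord_sum.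
rewrite (bspan_eq _ _ fB fB0).
rewrite (bcoord_sum (Belt_bspan x fB fB0)) (bcoord_sum (Belt_bspan y fB fB0)).
rewrite mulr_suml; apply: memv_suml => a _; rewrite mulr_sumr.
apply: memv_suml => b _; rewrite -scalerAl -scalerAr !memvZ // gammaE.
by apply: memv_suml => c _; rewrite memvZ ?mem_bspan.
Qed.

End Bases.

(** * The differential of L in terms of elements and linear forms *)

Section BasisIndependence.
Variables (k : fieldType) (L : falgType k) (n : nat) (e : 'I_n -> L).
Variable R : {vspace L}.
Hypothesis eNcorner : forall i, e i \notin corner e R i i.
Variable LL : box k 'I_n.

Local Notation Q := (L_biquiver e R).
Local Notation frame := (forall i j, (\dim (corner e R i j)).-tuple L).
Local Notation A := (bcat LL).
Local Notation V := (bbim LL).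

Section Values.
Variables (B : frame) (gamma : forall i j l : 'I_n,
  Bset e R i j -> Bset e R j l -> Bset e R i l -> k).
Variables (s : forall i j, solid Q i j -> A i j)
          (t : forall i j, dotted Q i j -> V i j).
Variable F : forall i j, L -> A i j.
Hypothesis Flin : forall i j, linear (@F i j).
Hypothesis FE : forall i j (b : solid Q i j), F i j (Belt B b) = s b.

(** The differential of a solid arrow extended linearly to elements u of the
    algebra, where F extends the values of the solid arrows. *)
Definition solid_differential i j (u : L) : V i j :=
  \sum_l \sum_(x : 'I_(\dim (corner e R j l)))
    lact (F i l (u * tnth (B j l) x)) (t (star x))
  - \sum_l \sum_(y : 'I_(\dim (corner e R l i)))
    ract (t (star y)) (F l j (tnth (B l i) y * u)).

Lemma solid_differential_linear i j : linear (@solid_differential i j).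
Proof.
move=> c u v; rewrite /solid_differential scalerBr addrACA -opprD.
rewrite !scaler_sumr -!big_split /=; congr (_ - _); apply: eq_bigr => l _.
  rewrite scaler_sumr -big_split; apply: eq_bigr => x _ /=.
  by rewrite mulrDl -scalerAl Flin lact_linl.
rewrite scaler_sumr -big_split; apply: eq_bigr => x _ /=.
by rewrite mulrDr -scalerAr Flin ract_linr.
Qed.

Hypothesis gammaE : structure_constants B gamma.

Lemma pathmod_valU d i j (p : bqpath Q d i j) :
  pathmod_val s t << p >> = path_val s t p.
Proof. exact: malg_liftU. Qed.

Lemma L_dsolid_val i j (b : solid Q i j) :
  pathmod_val s t (L_dsolid gamma b) = solid_differential i j (Belt B b).
Proof.
rewrite /L_dsolid (linear_eqB (@pathmod_val_linear _ _ _ _ _ _ _ _ _)).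
congr (_ - _); rewrite (linear_eq_sum (@pathmod_val_linear _ _ _ _ _ _ _ _ _)).
  apply: eq_bigr => l _.
  rewrite (linear_eq_sum (@pathmod_val_linear _ _ _ _ _ _ _ _ _)).
  apply: eq_bigr => x _.
  rewrite (linear_eq_sumZ (@pathmod_val_linear _ _ _ _ _ _ _ _ _)).
  have := gammaE b (rad_index x); rewrite [Belt B (rad_index x)]/= => ->.
  rewrite (linear_eq_sumZ (Flin _ _)) (linear_eq_sumZ (lact_linl _)).
  by apply: eq_bigr => y _; rewrite pathmod_valU /= ract1 FE.
apply: eq_bigr => l _.
rewrite (linear_eq_sum (@pathmod_val_linear _ _ _ _ _ _ _ _ _)).
apply: eq_bigr => y _.
rewrite (linear_eq_sumZ (@pathmod_val_linear _ _ _ _ _ _ _ _ _)).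
have := gammaE (rad_index y) b; rewrite [Belt B (rad_index y)]/= => ->.
rewrite (linear_eq_sumZ (Flin _ _)) (linear_eq_sumZ (ract_linr _)).
by apply: eq_bigr => x _; rewrite pathmod_valU /= compc1 FE.
Qed.

(** The differential of a dotted arrow extended to linear forms f; the arrow
    dual to b corresponds to the form bcoord B b. *)
Definition dotted_differential i j (f : L -> k) : tensor V V i j :=
  \sum_l \sum_(x : 'I_(\dim (corner e R j l)))
    \sum_(y : 'I_(\dim (corner e R l i)))
      f (tnth (B j l) x * tnth (B l i) y) *: tens (t (star y)) (t (star x)).

Hypothesis frameB : is_frame B.

Lemma L_ddotted_val i j (b : dotted Q i j) :
  pathmod_val s t (L_ddotted gamma b)
    = dotted_differential i j (bcoord B (@rad_index k L n e R j i b)).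
Proof.
rewrite /L_ddotted (linear_eq_sum (@pathmod_val_linear _ _ _ _ _ _ _ _ _)).
apply: eq_bigr => l _.
rewrite (linear_eq_sum (@pathmod_val_linear _ _ _ _ _ _ _ _ _)).
apply: eq_bigr => x _.
rewrite (linear_eq_sumZ (@pathmod_val_linear _ _ _ _ _ _ _ _ _)).
apply: eq_bigr => y _.
rewrite pathmod_valU.
have -> : path_val s t (pdotted (star y) (pdotted (star x) (pnil j)))
    = tens (t (star y)) (t (star x)).
  rewrite [LHS]/=.
  by rewrite ract1.
rewrite (structure_constantsE eNcorner _ _ _ frameB gammaE).
rewrite [Belt B (rad_index x)]/= [Belt B (rad_index y)]/=.
reflexivity.
Qed.

(** A form that vanishes on the idempotents is the combination of the forms
    bcoord B b with coefficients f(b), and the differential is linear in the form. *)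
Lemma dotted_differential_sum i j (f : L -> k) : linear (f : L -> k^o) ->
    (forall y, f (Belt B (inr y : Bset e R j i)) = 0) ->
  dotted_differential i j f
    = \sum_(b : 'I_(\dim (corner e R j i))) f (Belt B (rad_index b)) *:
        dotted_differential i j (bcoord B (@rad_index k L n e R j i b)).
Proof.
move=> fl f0.
have fE u : u \in bspan B j i -> f u = \sum_(b : 'I_(\dim (corner e R j i)))
    f (Belt B (rad_index b)) * bcoord B (@rad_index k L n e R j i b) u.
  move=> uB; rewrite {1}(bcoord_sum uB) (linear_form_sumZ _ _ _ _ fl).
  rewrite big_sumType /= [X in _ + X]big1 => [|z _]; last by rewrite (f0 z) mulr0.
  by rewrite addr0; apply: eq_bigr => b _; rewrite mulrC.
under [RHS]eq_bigr do rewrite scaler_sumr.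
rewrite [RHS]exchange_big; apply: eq_bigr => l _ /=.
under [RHS]eq_bigr do rewrite scaler_sumr.
rewrite [RHS]exchange_big; apply: eq_bigr => x _ /=.
under [RHS]eq_bigr do rewrite scaler_sumr.
rewrite [RHS]exchange_big; apply: eq_bigr => y _ /=.
rewrite fE; last first.
  have := gammaE (rad_index x) (rad_index y) => /= ->.
  by apply: memv_suml => b _; rewrite memvZ // mem_bspan.
move: (tens _ _) => v; rewrite scaler_suml; apply: eq_bigr => b _.
by rewrite scalerA.
Qed.

End Values.

Variables (B B' : frame).
Hypotheses (frameB : is_frame B) (frameB' : is_frame B').
Variables (s : forall i j, solid Q i j -> A i j)
          (t : forall i j, dotted Q i j -> V i j).

(** The linear extension of s to the elements of the algebra. *)
Definition eltval i j (u : L) : A i j :=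
  \sum_(b : Bset e R i j) bcoord B b u *: s (b : solid Q i j).

Lemma eltval_linear i j : linear (@eltval i j).
Proof.
move=> c u v; rewrite scaler_sumr -big_split /=; apply: eq_bigr => b _.
by rewrite linearP scalerDl scalerA.
Qed.

Lemma eltval_Belt i j (b : solid Q i j) : eltval i j (Belt B b) = s b.
Proof.
rewrite -[RHS](sum_delta b (fun c : Bset e R i j => s (c : solid Q i j))).
by apply: eq_bigr => c _; rewrite bcoord_Belt // eq_sym.
Qed.

(** The element of the new dual basis at v, evaluated at the old basis: the
    dotted arrows are transformed contragrediently to the solid ones. *)
Definition new_dotted i j (v : dotted Q i j) : V i j :=
  \sum_(w : dotted Q i j)
    bcoord B' (@rad_index k L n e R j i v) (Belt B (rad_index w)) *: t w.

(** The canonical element sum_x x (x) x', with x' the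
    arrow dual to x, has the same image under a bilinear map for both bases. *)
Lemma new_dotted_dual i j (M : lmodType k) (phi : L -> V j i -> M) :
    (forall v, linear (phi^~ v)) -> (forall u, linear (phi u)) ->
  \sum_(x : 'I_(\dim (corner e R i j)))
      phi (tnth (B' i j) x) (new_dotted (star x))
    = \sum_(x : 'I_(\dim (corner e R i j))) phi (tnth (B i j) x) (t (star x)).
Proof.
move=> phil phir.
under eq_bigr do rewrite (linear_eq_sumZ (phir _)).
rewrite exchange_big /=; apply: eq_bigr => w _.
have wR : tnth (B i j) w \in corner e R i j.
  by rewrite (basis_mem (frameB i j)) // mem_tnth.
rewrite [in RHS](bcoord_corner_sum eNcorner frameB' wR).
by rewrite (linear_eq_sumZ (phil _)).
Qed.

Lemma solid_differential_new i j u :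
  solid_differential B' new_dotted eltval i j u
    = solid_differential B t eltval i j u.
Proof.
congr (_ - _); apply: eq_bigr => l _.
  apply: (new_dotted_dual (phi := fun v => lact (eltval i l (u * v)))) => [v|v].
    move=> c x y; rewrite mulrDr -scalerAr eltval_linear lact_linl //.
  exact: lact_linr.
apply: (new_dotted_dual
  (phi := fun v x => ract x (eltval l j (v * u)))) => [v|v].
  by move=> c x y; rewrite mulrDl -scalerAl eltval_linear ract_linr.
exact: ract_linl.
Qed.

Lemma dotted_differential_new i j f : linear (f : L -> k^o) ->
  dotted_differential B' new_dotted i j f = dotted_differential B t i j f.
Proof.
move=> fl; apply: eq_bigr => l _.
pose G u (v : V l j) : tensor V V i j := \sum_(y : 'I_(\dim (corner e R l i)))
  f (u * tnth (B l i) y) *: tens (t (star y)) v.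
transitivity (\sum_(x : 'I_(\dim (corner e R j l)))
   G (tnth (B' j l) x) (new_dotted (star x))); last first.
  apply: (new_dotted_dual (phi := G)) => [v|u].
    apply: linear_sum_scale => y c u u'.
    by rewrite mulrDl -scalerAl fl.
  by apply: linear_scale_sum => y; apply: tens_linr.
apply: eq_bigr => x _.
apply: (new_dotted_dual
  (phi := fun u v => f (tnth (B' j l) x * u) *: tens v _)) => [v|u].
  move=> c u u'; rewrite mulrDr -scalerAr fl.
  by rewrite scalerDl scalerA.
move=> c v v'; rewrite tens_linl.
by rewrite scalerDr !scalerA mulrC.
Qed.

End BasisIndependence.

(** * Independence of the box from the bases *)

Section BoxBasisIndependence.
Variables (k : fieldType) (L : falgType k) (n : nat) (e : 'I_n -> L).
Variable R : {vspace L}.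
Hypothesis eNcorner : forall i, e i \notin corner e R i i.
Local Notation frame := (forall i j, (\dim (corner e R i j)).-tuple L).
Local Notation Q := (L_biquiver e R).

Lemma bcoord_inverse (B B' : frame) i j (a c : Bset e R i j) :
    is_frame B -> is_frame B' ->
  \sum_(b : Bset e R i j) bcoord B b (Belt B' a) * bcoord B' c (Belt B b) = (a == c)%:R.
Proof.
move=> fB fB'; rewrite eq_sym -(bcoord_Belt eNcorner c a fB').
rewrite [in RHS](bcoord_sum (Belt_bspan a fB' fB)) linear_sum.
by apply: eq_bigr => b _; rewrite linearZ.
Qed.

Lemma bcoord_inverse_dual (B B' : frame) i j
    (a c : 'I_(\dim (corner e R i j))) : is_frame B -> is_frame B' ->
  \sum_(w : 'I_(\dim (corner e R i j))) bcoord B' (@rad_index k L n e R i j a) (Belt B (rad_index w))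
    * bcoord B (@rad_index k L n e R i j w) (Belt B' (rad_index c))
  = (a == c)%:R.
Proof.
move=> fB fB'.
have cR : Belt B' (@rad_index k L n e R i j c) \in corner e R i j.
  by rewrite (basis_mem (fB' i j)) // mem_tnth.
transitivity (bcoord B' (@rad_index k L n e R i j a) (Belt B' (rad_index c))).
  rewrite {2}(bcoord_corner_sum eNcorner fB cR) linear_sum.
  by apply: eq_bigr => w _; rewrite linearZ mulrC.
by rewrite bcoord_Belt.
Qed.

(** The new generators are the images of the new basis under the linear
    extension of s, and the dual combinations of the dotted arrows.  As the
    differential is linear and does not see the bases, the equations that
    express that D is computed by the box need only be compared on the old
    basis, where they are known. *)
Lemma L_box_basis_independent (B B' : frame) gamma gamma' (LL : box k 'I_n) :
    is_frame B -> structure_constants B gamma ->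
    is_frame B' -> structure_constants B' gamma' ->
  has_differential_biquiver LL (L_differential gamma) ->
  has_differential_biquiver LL (L_differential gamma').
Proof.
move=> fB gammaE fB' gammaE' [s [t [w [normal cat_free ker_free [ds dt]]]]].
pose S i j (a b : solid Q i j) := bcoord B b (Belt B' a).
pose S' i j (a b : solid Q i j) := bcoord B' b (Belt B a).
pose T i j (v x : dotted Q i j) : k :=
  bcoord B' (@rad_index k L n e R j i v) (Belt B (rad_index x)).
pose T' i j (v x : dotted Q i j) : k :=
  bcoord B (@rad_index k L n e R j i v) (Belt B' (rad_index x)).
pose s' i j (a : solid Q i j) := eltval B s i j (Belt B' a).
pose t' := new_dotted B B' t.
have SS' i j (a c : solid Q i j) : \sum_b S i j a b * S' i j b c = (a == c)%:R.
  exact: bcoord_inverse.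
have S'S i j (a c : solid Q i j) : \sum_b S' i j a b * S i j b c = (a == c)%:R.
  exact: bcoord_inverse.
have TT' i j (v x : dotted Q i j) : \sum_b T i j v b * T' i j b x = (v == x)%:R.
  exact: bcoord_inverse_dual.
have T'T i j (v x : dotted Q i j) : \sum_b T' i j v b * T i j b x = (v == x)%:R.
  exact: bcoord_inverse_dual.
have sE i j (a : solid Q i j) : s' i j a = \sum_b S i j a b *: s i j b by [].
have tE i j (v : dotted Q i j) : t' i j v = \sum_x T i j v x *: t i j x by [].
exists s', t', w; split.
- exact: normal.
- exact: path_category_subst sE tE SS' S'S TT' T'T cat_free.
- exact: free_kernel_subst sE tE SS' S'S TT' T'T ker_free.
split=> [i j a|i j v].
  rewrite (L_dsolid_val t' (eltval_linear B s) _ gammaE') //.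
  rewrite solid_differential_new // /s'.
  rewrite {1}(bcoord_sum (Belt_bspan a fB' fB)) {2 3}/eltval.
  rewrite (linear_eq_sumZ (solid_differential_linear _ _ (eltval_linear B s) _ _)).
  rewrite (linear_eq_sumZ (ract_linr _)) (linear_eq_sumZ (lact_linl _)).
  rewrite -sumrB; apply: eq_bigr => b _; rewrite -scalerBr -ds.
  by rewrite (L_dsolid_val t (eltval_linear B s) (eltval_Belt _ _ _) gammaE).
rewrite (L_ddotted_val eNcorner _ _ gammaE' fB').
rewrite dotted_differential_new //; last exact: linearP.
set f := bcoord _ _.
have [mul _ _] := mu_morph LL.
rewrite /t' /new_dotted (linear_eq_sumZ (mul i j)).
rewrite (linear_eq_sumZ (tens_linl _)) (linear_eq_sumZ (tens_linr _)).
rewrite -!sumrB.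
transitivity (\sum_(b : dotted Q i j) f (Belt B (rad_index b)) *: pathmod_val s t (L_ddotted gamma b)).
  rewrite (dotted_differential_sum t gammaE) => [||y].
  - by apply: eq_bigr => b _; rewrite (L_ddotted_val eNcorner _ _ gammaE fB).
  - exact: linearP.
  have eB : Belt B (inr y : Bset e R j i) = Belt B' (inr y) by [].
  by rewrite /f eB bcoord_Belt.
by apply: eq_bigr => b _; rewrite -!scalerBr -dt.
Qed.
End BoxBasisIndependence.

(** * Triangularity for adapted bases *)

Section Corners.
Variables (k : fieldType) (L : falgType k) (n : nat) (e : 'I_n -> L).
Variable R : {vspace L}.
Hypothesis radR : is_radical R.
Hypothesis ee : forall i, e i * e i = e i.
Hypothesis e_neq0 : forall i, e i != 0.

Local Notation frame := (forall i j, (\dim (corner e R i j)).-tuple L).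
Local Notation P := (radical_power R).

Lemma corner_radical i j : (corner e R i j <= R)%VS.
Proof.
have lR := radical_left_ideal radR; have rR := radical_right_ideal radR.
apply: subv_trans rR; rewrite /corner; apply: prodvS; last exact: subvf.
by apply: subv_trans lR; apply: prodvSl; apply: subvf.
Qed.

Lemma corner_mull i j u : u \in corner e R i j -> e i * u = u.
Proof.
move=> uR; apply/eqP; rewrite -subr_eq0.
have: u \in lker (amull (e i) - \1)%VF.
  apply: (subvP _ _ uR); rewrite /corner -prodvA.
  apply/prodvP => _ v /vlineP[c ->] _.
  rewrite memv_ker !lfunE /= !lfunE /= id_lfunE.
  by rewrite -scalerAl -scalerAr mulrA ee subrr.
by rewrite memv_ker !lfunE /= !lfunE /= id_lfunE.
Qed.

Lemma corner_mulr i j u : u \in corner e R i j -> u * e j = u.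
Proof.
move=> uR; apply/eqP; rewrite -subr_eq0.
have: u \in lker (amulr (e j) - \1)%VF.
  apply: (subvP _ _ uR); apply/prodvP => v _ _ /vlineP[c ->].
  rewrite memv_ker !lfunE /= !lfunE /= id_lfunE.
  by rewrite -scalerAr -scalerAl -mulrA ee subrr.
by rewrite memv_ker !lfunE /= !lfunE /= id_lfunE.
Qed.

Lemma mem_corner i j u : u \in R -> e i * u = u -> u * e j = u ->
  u \in corner e R i j.
Proof.
move=> uR eu ue; rewrite -ue -eu.
by apply: memv_mul (memv_line _); apply: memv_mul; rewrite ?memv_line.
Qed.

Lemma idempotent_notin_corner i : e i \notin corner e R i i.
Proof.
apply/negP => /(subvP (corner_radical i i)) /(radical_idempotent radR (ee i)).
by apply/eqP.
Qed.

Lemma Belt_mull (B : frame) i j (b : Bset e R i j) : is_frame B ->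
  e i * Belt B b = Belt B b.
Proof.
move=> fB; case: b => [x|y] //=.
by apply: (@corner_mull i j); rewrite (basis_mem (fB i j)) // mem_tnth.
Qed.

Lemma Belt_mulr (B : frame) i j (b : Bset e R i j) : is_frame B ->
  Belt B b * e j = Belt B b.
Proof.
move=> fB; case: b => [x|[[] /= /eqP<-]] //=.
by apply: (@corner_mulr i j); rewrite (basis_mem (fB i j)) // mem_tnth.
Qed.

Lemma rad_index_corner (B : frame) i j x : is_frame B ->
  Belt B (@rad_index k L n e R i j x) \in corner e R i j.
Proof. by move=> fB; rewrite (basis_mem (fB i j)) // mem_tnth. Qed.

(** Each term of the radical filtration of a corner is spanned by the basis
    elements that it contains.  The powers start at R itself, since the corners
    are contained in R. *)
Definition adapted_frame (B : frame) : Prop := is_frame B /\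
  forall i j m, (P m.+1 :&: corner e R i j
    <= <<[seq x <- B i j | x \in P m.+1 :&: corner e R i j]>>)%VS.

Lemma adapted_frame_exists : exists B, adapted_frame B.
Proof.
have exB i j : {Bij : (\dim (corner e R i j)).-tuple L |
    basis_of (corner e R i j) Bij /\ forall m, (P m.+1 :&: corner e R i j
      <= <<[seq x <- Bij | x \in P m.+1 :&: corner e R i j]>>)%VS}.
  apply: cid.
  pose U m := (P m.+1 :&: corner e R i j)%VS.
  have [|| s bs sU] := @adapted_basis k L (\dim {:L}) U.
  - by move=> m; apply: capvS; rewrite ?radical_powerS.
  - apply/eqP; rewrite -subv0 -(radical_nilpotent radR).
    by apply: subv_trans (capvSl _ _) _; apply: radical_powerS.
  have U0 : U 0%N = corner e R i j.
    by apply/capv_idPr; rewrite radical_power1 // corner_radical.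
  rewrite U0 in bs.
  have size_s : size s == \dim (corner e R i j).
    by rewrite -(span_basis bs) eq_sym; apply: (basis_free bs).
  by exists (Tuple size_s); split.
exists (fun i j => sval (exB i j)).
by split=> i j; have [] := svalP (exB i j).
Qed.

Variable B : frame.
Hypothesis adB : adapted_frame B.
Let frameB : is_frame B := adB.1.
Let eNcorner := idempotent_notin_corner.

(** The basis elements outside R^(m+1) have coordinate 0 on the spanning set
    provided by the adaptedness of B, hence on all of its span. *)
Lemma adapted_bcoord i j m u (b : Bset e R i j) :
  u \in P m.+1 -> u \in corner e R i j -> bcoord B b u != 0 ->
  Belt B b \in P m.+1.
Proof.
move=> uP uR; apply: contraNT => bNP.
have : u \in lker (linfun (bcoord B b : L -> k^o)).
  have: u \in (P m.+1 :&: corner e R i j)%VS by rewrite memv_cap uP.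
  move/(subvP (adB.2 i j m)); apply: subvP; apply/span_subvP => x.
  rewrite mem_filter => /andP[]; rewrite memv_cap => /andP[xP _].
  case/tnthP=> y xE; rewrite memv_ker lfunE /= xE.
  have := bcoord_Belt eNcorner b (rad_index y) frameB; rewrite /= => ->.
  apply/eqP; case: eqP => [bE|//].
  by case/negP: bNP; rewrite bE /= -xE.
by rewrite memv_ker lfunE.
Qed.

(** As the filtration decreases, this is dim L - m if b is in R^m but not in
    R^(m+1); the idempotents have the largest value. *)
Definition height i j (b : Bset e R i j) : nat :=
  \sum_(m < (\dim {:L}).+1) (Belt B b \notin P m).

Lemma Belt_neq0 i j (b : Bset e R i j) : Belt B b != 0.
Proof.
apply/eqP => b0; have := bcoord_Belt eNcorner b b frameB.
by rewrite b0 linear0 eqxx => /esym/eqP; rewrite oner_eq0.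
Qed.

Lemma height_lt i j i' j' (b : Bset e R i j) (c : Bset e R i' j') :
  (forall m, Belt B b \in P m -> Belt B c \in P m.+1) ->
  (height c < height b)%N.
Proof.
(* Compare the m-th term for b with the (m+1)-st for c: the 0-th term for c is
   0, and the last one for b is 1 since that power of R is 0. *)
move=> bc; rewrite /height big_ord_recl big_ord_recr /= memvf add0n.
rewrite radical_nilpotent // memv0 Belt_neq0 addn1 ltnS.
apply: leq_sum => m _; rewrite -[(R * _)%VS]/(P m.+1).
by case: (boolP (Belt B b \in P m)) => [/bc->|_] //; apply: leq_b1.
Qed.

(** If b is in R^m, then b x is in R^(m+1) and in e_i R e_l, so that the basis
    elements that occur in it are in R^(m+1). *)
Lemma height_mulr i j l (b : Bset e R i j) (x : 'I_(\dim (corner e R j l)))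
    (y : Bset e R i l) :
  multiplication_table B b (rad_index x) y != 0 -> (height y < height b)%N.
Proof.
move=> by0; apply: height_lt => m bP.
have xR : Belt B (rad_index x) \in R.
  by apply: (subvP (corner_radical j l)); apply: rad_index_corner.
apply: adapted_bcoord by0.
  by apply: (subvP (radical_power_mulr radR m)); apply: memv_mul.
apply: mem_corner; last 1 first.
- by rewrite -mulrA Belt_mulr.
- by apply: ((left_idealP R).1 (radical_left_ideal radR)).
by rewrite mulrA Belt_mull.
Qed.

Lemma height_mull i j l (y : 'I_(\dim (corner e R l i))) (b : Bset e R i j)
    (x : Bset e R l j) :
  multiplication_table B (rad_index y) b x != 0 -> (height x < height b)%N.
Proof.
move=> by0; apply: height_lt => m bP.
have yR : Belt B (rad_index y) \in R.
  by apply: (subvP (corner_radical l i)); apply: rad_index_corner.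
apply: adapted_bcoord by0.
  by rewrite /radical_power iterS; apply: memv_mul.
apply: mem_corner; last 1 first.
- by rewrite -mulrA Belt_mulr.
- by apply: (subvP (radical_right_ideal radR)); rewrite memv_mul ?memvf.
by rewrite mulrA Belt_mull.
Qed.

End Corners.

(** * Elements supported by a predicate on paths *)

Section Support.
Variables (k : fieldType) (T : choiceType) (G : pred T).
Implicit Types u v : {malg k[T]}.

Definition supported u := forall p, p \in msupp u -> G p.

Lemma supportedB u v : supported u -> supported v -> supported (u - v).
Proof.
move=> su sv p; rewrite -mcoeff_neq0 mcoeffB => uvp.
have [up|] := boolP (p \in msupp u); first exact: su.
rewrite -mcoeff_eq0 => /eqP up0; apply: sv; rewrite -mcoeff_neq0.
by move: uvp; rewrite up0 sub0r oppr_eq0.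
Qed.

Lemma supported_sum (J : Type) (r : seq J) (u : J -> {malg k[T]}) :
  (forall x, supported (u x)) -> supported (\sum_(x <- r) u x).
Proof.
move=> su; elim/big_ind: _ => [p|v w sv sw|x _]; last exact: su.
  by rewrite msupp0.
rewrite -[w]opprK; apply: supportedB => // p; rewrite msuppN; exact: sw.
Qed.

Lemma supportedZU (c : k) q : (c != 0 -> G q) -> supported (c *: << q >>).
Proof.
move=> Gq p; rewrite -mcoeff_neq0 mcoeffZ mcoeffU.
by case: (q =P p) => [<-|_]; rewrite ?mulr1 // mulr0 eqxx.
Qed.

End Support.

(** * The BT-type differential *)

Section BTDifferential.
Variables (k : fieldType) (L : falgType k) (n : nat) (e : 'I_n -> L).
Variable R : {vspace L}.
Hypothesis radR : is_radical R.
Hypothesis ee : forall i, e i * e i = e i.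
Hypothesis e_neq0 : forall i, e i != 0.
Local Notation frame := (forall i j, (\dim (corner e R i j)).-tuple L).
Local Notation Q := (L_biquiver e R).
Variable B : frame.

Lemma L_solid_triangular : adapted_frame B ->
  solid_triangular (L_differential (@multiplication_table k L n e R B)).
Proof.
move=> adB; exists (fun i j (b : solid Q i j) => height B b) => i j b.
set G := all_solid _; suff: supported (@G 1 i j) (L_dsolid (@multiplication_table k L n e R B) b) by [].
apply: supportedB; do 3![apply: supported_sum => ?]; apply: supportedZU.
  by move/(height_mulr radR ee e_neq0 adB) => lt; rewrite /G /= lt.
by move/(height_mull radR ee e_neq0 adB) => lt; rewrite /G /= lt.
Qed.

Definition idem_loop i : solid Q i i := inr (exist _ tt (eqxx i)).

Lemma nonloop_radical i j (x : nonloop idem_loop i j) :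
  {b : 'I_(\dim (corner e R i j)) | val x = rad_index b}.
Proof.
case: x => -[b|y] /= xNloop; first by exists b.
case/negP: xNloop; apply/eqP.
move: (y) => [[] eqij]; have eij := eqP eqij; move: eqij.
by case: _ / eij => eqii; rewrite /idem_loop (bool_irrelevance eqii (eqxx i)).
Qed.

Lemma rad_index_nonloop i j (b : 'I_(\dim (corner e R i j))) :
  Tagged (solid Q i) (rad_index b : solid Q i j)
    != Tagged (solid Q i) (idem_loop i).
Proof.
apply/eqP.
move/(congr1 (fun x : {l & solid Q i l} => if tagged x is inl _ then true else false)).
by [].
Qed.

(** The map x |-> x~ of the definition of BT-type sends a radical basis element
    to the arrow dual to it. *)
Definition loop_dual i j (x : nonloop idem_loop i j) : dotted Q j i :=
  star (sval (nonloop_radical x)).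

Lemma loop_dualE i j (x : nonloop idem_loop i j) :
  val x = rad_index (loop_dual x).
Proof. exact: svalP (nonloop_radical x). Qed.

Lemma loop_dual_inj i j : injective (@loop_dual i j).
Proof. by move=> x y xy; apply: val_inj; rewrite !loop_dualE xy. Qed.

Lemma sum_nonloop (M : lmodType k) i j (u : solid Q i j -> dotted Q j i -> M) :
  \sum_(x : nonloop idem_loop i j) u (val x) (loop_dual x)
    = \sum_(b : 'I_(\dim (corner e R i j))) u (rad_index b) (star b).
Proof.
pose f b : nonloop idem_loop i j := Sub (rad_index b : solid Q i j) (rad_index_nonloop b).
have fK : cancel f (@loop_dual i j).
  by move=> b; have := loop_dualE (f b); rewrite /= => -[].
rewrite (reindex f); last first.
  exists (@loop_dual i j) => [b|x] _; first exact: fK.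
  by apply: val_inj; rewrite /= [RHS]loop_dualE.
by apply: eq_bigr => b _; rewrite fK.
Qed.

Hypothesis frameB : is_frame B.
Let eNcorner := idempotent_notin_corner radR ee e_neq0.

(** As e_i is a unit on the elements of the corners, gamma(e_i,x,y) and
    gamma(x,e_i,y) are 1 if x = y and 0 otherwise. *)
Lemma idem_loop_differential i :
  L_dsolid (@multiplication_table k L n e R B) (idem_loop i)
    = BT_sum k loop_dual i.
Proof.
rewrite /L_dsolid /BT_sum; congr (_ - _); apply: eq_bigr => l _.
  rewrite (sum_nonloop (fun x v => << psolid x (pdotted v (pnil i)) >>)).
  apply: eq_bigr => x _.
  rewrite -[RHS](sum_delta (rad_index x) (fun y : Bset e R i l =>
    << psolid (y : solid Q i l) (pdotted (star x) (pnil i)) >>)).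
  apply: eq_bigr => y _; congr (_ *: _).
  rewrite eq_sym -(bcoord_Belt eNcorner _ _ frameB).
  by rewrite /multiplication_table Belt_mull.
rewrite (sum_nonloop (fun x v => << pdotted v (psolid x (pnil i)) >>)).
apply: eq_bigr => x _.
rewrite -[RHS](sum_delta (rad_index x) (fun y : Bset e R l i =>
  << pdotted (star x) (psolid (y : solid Q l i) (pnil i)) >>)).
apply: eq_bigr => y _; congr (_ *: _).
rewrite eq_sym -(bcoord_Belt eNcorner _ _ frameB).
by rewrite /multiplication_table Belt_mulr.
Qed.

End BTDifferential.

Theorem proposition5p1 (k : closedFieldType) (L : falgType k)
    (n : nat) (e : 'I_n -> L) (he : basic_decomposition e)
    (R : {vspace L}) (hR : is_radical R)
    (B0 : forall i j : 'I_n, (\dim (corner e R i j)).-tuple L)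
    (hB0 : forall i j : 'I_n, basis_of (corner e R i j) (B0 i j))
    (gamma : forall i j l : 'I_n,
       Bset e R i j -> Bset e R j l -> Bset e R i l -> k)
    (hgamma : structure_constants B0 gamma)
    (LL : box k 'I_n)
    (hLL : has_differential_biquiver LL (L_differential gamma)) :
  BT_type LL.
Proof.
have [_ prim _ _] := he.
have ee i : e i * e i = e i by have [] := prim i.
have e_neq0 i : e i != 0 by have [_ /eqP] := prim i.
have [B adB] := adapted_frame_exists e hR.
have eNcorner := idempotent_notin_corner hR ee e_neq0.
exists (L_biquiver e R), (L_differential (@multiplication_table k L n e R B)).
split.
- apply: (L_box_basis_independent eNcorner hB0 hgamma adB.1 _ hLL).
  exact: multiplication_tableP hB0 hgamma adB.1.
- exact: L_solid_triangular hR ee e_neq0 _ adB.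
exists (@idem_loop k L n e R), (@loop_dual k L n e R).
split=> [i j|i]; first exact: loop_dual_inj.
exact: idem_loop_differential hR ee e_neq0 _ adB.1 i.
Qed.
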